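(* Let $p$ be prime and $\lambda_p=2-\frac1p$. Define $(m_k^{(p)})_{k\ge0}$ by $m_0^{(p)}=m_1^{(p)}=1$ and, for $k\ge2$, \[ m_k^{(p)}=\frac1{p-1}\,\frac{\lambda_p-1}{\lambda_p^k-\lambda_p}\sum_{\substack{i_1+\cdots+i_p=k\\ i_1,\ldots,i_p<k}}\binom{k}{i_1,\ldots,i_p}\prod_{\ell=1}^p m_{i_\ell}^{(p)}, \] the sum being over nonnegative integers $i_1,\dots,i_p$. Then there exists a unique probability distribution with support $(0,\infty)$ whose $k$-th moment equals $m_k^{(p)}$ for every positive integer $k$.
   Context: $\binom{k}{i_1,\ldots,i_p}=\frac{k!}{i_1!\cdots i_p!}$ is the multinomial coefficient. *)

(* Defs.v *)
From HB Require Import structures.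
From mathcomp Require Import all_boot all_order all_algebra.
From mathcomp Require Import all_classical all_reals all_analysis.
Set Implicit Arguments.
Unset Strict Implicit.
Unset Printing Implicit Defensive.
Import Order.TTheory GRing.Theory Num.Theory.
Import numFieldNormedType.Exports.
Local Open Scope classical_set_scope.
Local Open Scope ring_scope.

Definition lam (R : realType) (p : nat) : R := 2 - p%:R^-1.

Definition multinom (R : realType) (p k : nat) (i : {ffun 'I_p -> 'I_k}) : R :=
  k`!%:R / \prod_(l < p) (i l)`!%:R.

(* Right-hand side of the recursion, as a function of the sequence [m].
   The constraints i_1, ..., i_p < k are carried by the index type 'I_k. *)
Definition mom_step (R : realType) (p : nat) (m : nat -> R) (k : nat) : R :=
  (p%:R - 1)^-1 * ((lam R p - 1) / (lam R p ^+ k - lam R p)) *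
  \sum_(i : {ffun 'I_p -> 'I_k} | (\sum_(l < p) i l)%N == k)
     multinom R i * \prod_(l < p) m (i l).

(* The recursion for [mom] is course-of-values; [n] is fuel, and any [n >= k]
   gives the same value at [k] (see [momE]). *)
Fixpoint mom_fuel (R : realType) (p n k : nat) : R :=
  if n is n'.+1 then
    if (k < 2)%N then 1 else mom_step p (mom_fuel R p n') k
  else 1.

Definition mom (R : realType) (p k : nat) : R := mom_fuel R p k k.

Lemma mom_step_ext (R : realType) (p k : nat) (m m' : nat -> R) :
  (forall j, (j < k)%N -> m j = m' j) -> mom_step p m k = mom_step p m' k.
Proof.
move=> mm'; congr (_ * _); apply: eq_bigr => i _; congr (_ * _).
by apply: eq_bigr => l _; exact: mm'.
Qed.

Lemma mom_fuelE (R : realType) (p n k : nat) :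
  (k <= n)%N -> mom_fuel R p n k = mom R p k.
Proof.
suff H a : forall b k0, (k0 <= a)%N -> (k0 <= b)%N ->
    mom_fuel R p a k0 = mom_fuel R p b k0 by move=> kn; exact: H.
elim: a => [|a IH] [|b] [|k0] //= ka kb; case: ifP => // _.
apply: mom_step_ext => j jk; apply: IH.
- exact: leq_trans (jk : (j <= k0)%N) ka.
- exact: leq_trans (jk : (j <= k0)%N) kb.
Qed.

Lemma mom0 (R : realType) (p : nat) : mom R p 0 = 1.
Proof. by []. Qed.

Lemma mom1 (R : realType) (p : nat) : mom R p 1 = 1.
Proof. by []. Qed.

Lemma momE (R : realType) (p k : nat) :
  (2 <= k)%N -> mom R p k = mom_step p (mom R p) k.
Proof.
case: k => [//|k] k2; rewrite /mom /= ltnNge k2 /=.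
by apply: mom_step_ext => j jk; exact: mom_fuelE.
Qed.

Definition topological_support (R : realType)
    (mu : probability (measurableTypeR R) R) : set R :=
  [set x | forall U : set R, open_nbhs x U -> (0 < mu U)%E].

(* The topological support is closed, so it cannot equal a non-closed set such
   as ]0, +oo[.  "mu has support D" means that mu is carried by D and charges
   every neighbourhood of every point of D; the topological support is then the
   closure of D, and the points outside D form a null set. *)
Definition has_support (R : realType)
    (mu : probability (measurableTypeR R) R) (D : set R) : Prop :=
  mu D = 1%E /\ D `<=` topological_support mu.

Lemma has_support_closure (R : realType)
    (mu : probability (measurableTypeR R) R) (D : set R) :
  measurable (D : set (measurableTypeR R)) -> has_support mu D ->
  topological_support mu = closure D.
Proof.
move=> mD [muD DS]; apply/seteqP; split => x /=.
- move=> Sx; apply: contrapT => nx.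
  have /Sx : open_nbhs x (~` closure D).
    by split=> //; apply: closed_openC; exact: closed_closure.
  apply/negP; rewrite -leNgt.
  have <- : mu (~` D) = 0%E by rewrite probability_setC// muD subee.
  apply: le_measure; rewrite ?inE.
  + apply: measurable_realfun.open_measurable; apply: closed_openC; exact: closed_closure.
  + exact: measurableC.
  + by apply: subsetC; exact: subset_closure.
- move=> cx U [oU Ux].
  have [y [Dy Uy]] := cx U (open_nbhs_nbhs (conj oU Ux)).
  exact: (DS y Dy) U (conj oU Uy).
Qed.

(* Main.v *)
From HB Require Import structures.
Require Import Defs.
From mathcomp Require Import all_boot all_order all_algebra.
From mathcomp Require Import all_classical all_reals all_analysis.
From mathcomp Require Import measurable_realfun.
From mathcomp Require Import ring lra zify.
Import Order.TTheory GRing.Theory Num.Theory.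
Import numFieldNormedType.Exports.
Local Open Scope classical_set_scope.
Local Open Scope ring_scope.
Set Implicit Arguments.
Unset Strict Implicit.
Unset Printing Implicit Defensive.

(** Write f(t) = t^p / p + (1 - 1/p) t and M(s) for the exponential generating
    function of the sequence m. In the p-th power of M the index tuples that
    the recursion leaves out are those with one entry k and zeros elsewhere;
    they contribute p m_k. After moving them to the left the recursion reads
    M(lambda s) = f(M(s)). This is the equation satisfied by the moment
    generating function of the limit W of Z_n / lambda^n, where Z_n is the
    Galton-Watson process started from one individual in which every
    individual has p children with probability 1/p and one child otherwise;
    the mean number of children is lambda. The law sought is that of W.

    Means over Z_n are finite sums, and the operator next_mean computes them
    without any probability space. The process itself is only needed to have
    a limit: it is run on the unit interval, all its randomness coming from
    one uniform variable that is split again and again (integral_split_unit).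
    Its scaled values have increments that are summable in mean, hence they
    converge almost everywhere (scaled_population_cvg). Of the limit law only
    one property is retained, the Fatou inequality of exists_limit_law;
    everything else about it is a statement on the means over Z_n.

    The moments of Z_n / lambda^n converge to m (scaled_moment_cvg), and by
    two applications of the Fatou inequality the limit law has the limiting
    moments (limit_law_abs_moment). For positivity and for full support,
    condition on the size z of generation n: the rest of the process is z
    independent copies of it, with mean z and variance proportional to z
    (scaled_second_moment). As z grows this forces the limit away from 0
    (limit_law_Ny0). And since every size congruent to 1 modulo p - 1 and at
    most p^n has positive probability (reachable_gt0), after scaling these
    sizes are dense in the half-line, and the limit comes close to each of
    them with positive probability (limit_law_itv_gt0).

    For uniqueness, M is entire (mom_series_bounded). So the Laplace transform
    of any law on the positive half-line with moments m is the alternating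
    moment series, and polynomials in e^(-x), whose means are therefore
    determined, approximate the indicator of every ray (moment_determinate). *)

(** * Expectations over one and several generations *)

(** The mean of h (c + S), where S is the sum of z independent offspring
    numbers, each p with probability 1/p and 1 otherwise. Summing the
    offspring of one individual at a time into c makes every mean computed
    below a short induction on z. *)
Fixpoint offspring_mean {R : realType} (p z c : nat) (h : nat -> R) : R :=
  if z is z'.+1 then
    p%:R^-1 * offspring_mean p z' (c + p)%N h +
    (1 - p%:R^-1) * offspring_mean p z' c.+1 h
  else h c.

(** The transition operator of the process: iter n (next_mean p) h z is the
    mean of h (Z_n) for Z_0 = z. *)
Definition next_mean {R : realType} (p : nat) (h : nat -> R) (z : nat) : R :=
  offspring_mean p z 0 h.

(** The offspring generating function when r = 1/p; it is also applied to
    polynomials, with r a constant polynomial. *)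
Definition pgf {R : nzRingType} (r : R) (p : nat) (t : R) : R :=
  r * t ^+ p + (1 - r) * t.

Section Generations.
Variables (R : realType) (p : nat).
Hypothesis p_gt1 : (1 < p)%N.
Local Notation lambda := (lam R p).
Implicit Types (h g : nat -> R) (n c z : nat).

Let p0 : (0 : R) < p%:R. Proof. by rewrite ltr0n ltnW. Qed.
Let pV_gt0 : (0 : R) < p%:R^-1. Proof. by rewrite invr_gt0. Qed.
Let pV_le : (p%:R^-1 : R) <= 2^-1.
Proof. by rewrite lef_pV2 ?posrE// ler_nat. Qed.

Lemma lam_gt1 : 1 < lambda.
Proof. rewrite /lam; move: pV_le; lra. Qed.

Lemma lam_gt0 : 0 < lambda.
Proof. exact: lt_trans lam_gt1. Qed.

Lemma offspring_mean_ext z c h g :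
  h =1 g -> offspring_mean p z c h = offspring_mean p z c g.
Proof. by move=> hg; elim: z c => [|z IH] c //=; rewrite !IH. Qed.

Lemma offspring_mean_le z c h g :
  (forall b, (c + z <= b <= c + p * z)%N -> h b <= g b) ->
  offspring_mean p z c h <= offspring_mean p z c g.
Proof.
elim: z c => [|z IH] c hg /=; first by apply: hg; rewrite muln0 addn0 leqnn.
have r1 : 0 <= (1 : R) - p%:R^-1 by move: pV_le; lra.
have r0 := ltW pV_gt0.
apply: lerD; apply: ler_wpM2l => //.
- by apply: IH => b /andP[b1 b2]; apply: hg; rewrite mulnS; lia.
- by apply: IH => b /andP[b1 b2]; apply: hg; rewrite mulnS; lia.
Qed.

Lemma offspring_meanZ z c a h :
  offspring_mean p z c (fun b => a * h b) = a * offspring_mean p z c h.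
Proof. by elim: z c => [|z IH] c //=; rewrite !IH; ring. Qed.

Definition offspring_var : R := p%:R + 1 - p%:R^-1 - lambda ^+ 2.

(** The one computation behind all first and second moments: c + S has mean
    c+lambda*z and variance z*offspring_var. *)
Lemma offspring_mean_quad z c (a1 a2 a3 : R) :
  offspring_mean p z c (fun b => a1 * b%:R ^+ 2 + a2 * b%:R + a3) =
  a1 * ((c%:R + lambda * z%:R) ^+ 2 + offspring_var * z%:R)
  + a2 * (c%:R + lambda * z%:R) + a3.
Proof.
have pn0 : p%:R != 0 :> R by rewrite gt_eqF.
elim: z c => [|z IH] c /=; first by rewrite !mulr0 !addr0.
rewrite !IH natrD -(natr1 c) -(natr1 z) /offspring_var /lam.
by field.
Qed.

Lemma offspring_var_ge0 : 0 <= offspring_var.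
Proof.
have pn0 : p%:R != 0 :> R by rewrite gt_eqF.
rewrite (_ : offspring_var = (p%:R - 1) ^+ 2 * p%:R^-1 * (1 - p%:R^-1)).
  apply: mulr_ge0; last by move: pV_le; lra.
  by rewrite mulr_ge0 ?sqr_ge0 ?ltW.
by rewrite /offspring_var /lam; field.
Qed.

Lemma next_mean_ext h g : h =1 g -> next_mean p h =1 next_mean p g.
Proof. by move=> hg z; exact: offspring_mean_ext. Qed.

Lemma iter_mean_ext n h g :
  h =1 g -> iter n (next_mean p) h =1 iter n (next_mean p) g.
Proof. by move=> hg; elim: n => //= n IH; exact: next_mean_ext. Qed.

Lemma iter_meanZ n a h z :
  iter n (next_mean p) (fun b => a * h b) z = a * iter n (next_mean p) h z.
Proof.
elim: n z => //= n IH z; rewrite (next_mean_ext IH); exact: offspring_meanZ.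
Qed.

Lemma next_mean_le z h g :
  (forall b, (z <= b <= p * z)%N -> h b <= g b) ->
  next_mean p h z <= next_mean p g z.
Proof. by move=> hg; apply: offspring_mean_le => b; rewrite !add0n => /hg. Qed.

Lemma iter_mean_le n z h g : (0 < z)%N ->
  (forall b, (0 < b)%N -> h b <= g b) ->
  iter n (next_mean p) h z <= iter n (next_mean p) g z.
Proof.
move=> z0 hg; elim: n z z0 => [|n IH] z z0 /=; first exact: hg.
by apply: next_mean_le => b /andP[zb _]; apply: IH; exact: leq_trans zb.
Qed.

Lemma iter_mean_cst n (a : R) z : iter n (next_mean p) (fun=> a) z = a.
Proof.
elim: n z => //= n IH z; rewrite (next_mean_ext IH) /next_mean.
have := offspring_mean_quad z 0 0 0 a; rewrite !mul0r !add0r => {2}<-.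
by apply: offspring_mean_ext => b; rewrite !mul0r !add0r.
Qed.

Lemma iter_mean_id n z :
  iter n (next_mean p) (fun c => c%:R) z = lambda ^+ n * z%:R.
Proof.
elim: n z => [|n IH] z /=; first by rewrite expr0 mul1r.
rewrite (next_mean_ext IH) /next_mean.
have := offspring_mean_quad z 0 0 (lambda ^+ n) 0.
rewrite !mul0r !add0r addr0 mulrA -exprSr => <-.
by apply: offspring_mean_ext => b; rewrite mul0r add0r addr0.
Qed.

(** The variance of the limit of Z_n / lambda^n for Z_0 = 1. It is the fixed
    point C of C = (offspring_var + lambda C) / lambda^2, which is the
    relation that conditioning on the first generation gives. *)
Definition limit_var : R := offspring_var / (lambda * (lambda - 1)).

Lemma limit_var_ge0 : 0 <= limit_var.
Proof.
rewrite divr_ge0 ?offspring_var_ge0 ?mulr_ge0 ?(ltW lam_gt0)//.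
by rewrite subr_ge0 ltW ?lam_gt1.
Qed.

(** From Z_0 = z the scaled population stays near z, uniformly in n. The
    deviation is small against z when z is large; used as in Chebyshev's
    inequality, this replaces independence of the z lines of descent in the
    proofs of positivity and of full support. *)
Lemma scaled_second_moment n z (m : R) :
  iter n (next_mean p) (fun c => (c%:R / lambda ^+ n - m) ^+ 2) z <=
  (z%:R - m) ^+ 2 + limit_var * z%:R.
Proof.
have l0 := lam_gt0; have ln0 : lambda != 0 by rewrite gt_eqF.
have l1 : lambda - 1 != 0 by rewrite subr_eq0 gt_eqF// lam_gt1.
elim: n z m => [|n IH] z m /=.
  by rewrite expr0 divr1 lerDl mulr_ge0 ?limit_var_ge0 ?ler0n.
pose g c : R := lambda ^- 2 *
  ((c%:R - lambda * m) ^+ 2 + limit_var * c%:R).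
apply: (@le_trans _ _ (next_mean p g z)).
  apply: next_mean_le => b _; rewrite /g.
  apply: (le_trans _ (ler_wpM2l _ (IH b (lambda * m)))); last first.
    by rewrite invr_ge0 exprn_ge0 ?ltW.
  rewrite -iter_meanZ le_eqVlt; apply/orP; left; apply/eqP.
  apply: iter_mean_ext => c; rewrite [lambda ^+ n.+1]exprS.
  have : lambda ^+ n != 0 by rewrite expf_neq0.
  by move: (lambda ^+ n) => ln ln0'; field; apply/andP.
rewrite /next_mean (@offspring_mean_ext _ _ _ (fun b => lambda ^- 2 * b%:R ^+ 2 +
   lambda ^- 2 * (limit_var - 2 * lambda * m) * b%:R + m ^+ 2)); last first.
  by move=> b; rewrite /g; field.
rewrite offspring_mean_quad le_eqVlt; apply/orP; left; apply/eqP; rewrite /limit_var.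
by field; apply/andP.
Qed.

(** The convex function 1/x lies below its chord between z and p*z, where the
    next population is found; so the mean of 1/Z_n decays geometrically. *)
Lemma mean_inverse n z : (0 < z)%N ->
  iter n (next_mean p) (fun c => c%:R^-1) z <=
  (1 - (lambda - 1) / p%:R) ^+ n / z%:R.
Proof.
set rho := 1 - _.
have rho0 : 0 <= rho.
  rewrite /rho /lam; move: pV_le pV_gt0; set r := p%:R^-1 => r1 r2; nra.
have pn0 : p%:R != 0 :> R by rewrite gt_eqF.
elim: n z => [|n IH] z z0 /=; first by rewrite expr0 mul1r.
have z0' : (0 : R) < z%:R by rewrite ltr0n.
(* The new right-hand side is the chord of rho^n/x between z and p*z. *)
apply: (@le_trans _ _ (next_mean p (fun c => 0 * c%:R ^+ 2 +
    (- rho ^+ n / (p%:R * z%:R ^+ 2)) * c%:R +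
    rho ^+ n * (z%:R^-1 + (p%:R * z%:R)^-1)) z)).
  apply: next_mean_le => b /andP[zb bz].
  apply: (le_trans (IH _ (leq_trans z0 zb))).
  rewrite (_ : _ + _ = rho ^+ n * (z%:R^-1 + (p%:R * z%:R)^-1
      - b%:R / (p%:R * z%:R ^+ 2))); last by ring.
  apply: ler_wpM2l; first exact: exprn_ge0.
  have b0 : (0 : R) < b%:R by rewrite ltr0n (leq_trans z0).
  rewrite -subr_ge0 (_ : _ - _ =
    (b%:R - z%:R) * (p%:R * z%:R - b%:R) / (b%:R * p%:R * z%:R ^+ 2)); last first.
    by field; rewrite !gt_eqF.
  rewrite divr_ge0 ?mulr_ge0 ?subr_ge0 ?ler_nat ?exprn_ge0 ?(ltW b0) ?(ltW z0')//.
  by rewrite -natrM ler_nat.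
rewrite /next_mean offspring_mean_quad le_eqVlt; apply/orP; left; apply/eqP.
rewrite [rho ^+ n.+1]exprS; move: (rho ^+ n) => rn; rewrite /rho.
by rewrite /lam; field; rewrite pn0 gt_eqF.
Qed.

Lemma offspring_mean_ge0 z c h :
  (forall b, 0 <= h b) -> 0 <= offspring_mean p z c h.
Proof.
move=> h0; have := @offspring_mean_quad z c 0 0 0.
rewrite !mul0r !add0r => <-; apply: offspring_mean_le => b _.
by rewrite !mul0r !add0r.
Qed.

Lemma iter_mean_ge0 n z h :
  (forall b, 0 <= h b) -> 0 <= iter n (next_mean p) h z.
Proof. by move=> h0; elim: n z => //= n IH z; exact: offspring_mean_ge0. Qed.

(** Exactly j of the z individuals having p children is a possible outcome. *)
Lemma offspring_mean_gt0 z c h j : (forall b, 0 <= h b) -> (j <= z)%N ->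
  0 < h (c + z + p.-1 * j)%N -> 0 < offspring_mean p z c h.
Proof.
have r1 : 0 < (1 : R) - p%:R^-1 by move: pV_le; lra.
move=> h0; elim: z c j => [|z IH] c [|j] //= jz.
- by rewrite muln0 !addn0.
- move=> hp; apply: ltr_wpDl.
    by rewrite mulr_ge0 ?offspring_mean_ge0// ltW.
  rewrite mulr_gt0// (IH _ 0%N)//.
  by rewrite addSnnS.
- move=> hp; apply: ltr_wpDr.
    by rewrite mulr_ge0 ?offspring_mean_ge0// ltW.
  rewrite mulr_gt0// (IH _ j)//.
  by move: hp; congr (0 < h _); rewrite mulnS; lia.
Qed.

(** All individuals multiply until one more generation suffices to hit the
    target, and from then on every individual has one child. *)
Lemma reachable_gt0 n w j : (w + p.-1 * j <= p ^ n * w)%N ->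
  (0 : R) < iter n (next_mean p) (fun c => (c == (w + p.-1 * j)%N)%:R) w.
Proof.
elim: n w j => [|n IH] w j.
  rewrite expn0 mul1n /= => wj.
  have -> : (w + p.-1 * j)%N = w.
    by apply/eqP; rewrite eqn_leq wj leq_addr.
  by rewrite eqxx ltr01.
move=> wj /=; case: (leqP j w) => jw.
  apply: (@offspring_mean_gt0 _ _ _ j) => //.
    by move=> b; apply: iter_mean_ge0 => ?; exact: ler0n.
  rewrite add0n; have := IH (w + p.-1 * j)%N 0%N.
  by rewrite muln0 addn0; apply; rewrite leq_pmull// expn_gt0 ltnW.
apply: (@offspring_mean_gt0 _ _ _ w) => //.
  by move=> b; apply: iter_mean_ge0 => ?; exact: ler0n.
rewrite add0n.
have -> : (w + p.-1 * j = (w + p.-1 * w) + p.-1 * (j - w))%N.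
  by rewrite -addnA -mulnDr subnKC// ltnW.
apply: IH; rewrite -addnA -mulnDr subnKC ?(ltnW jw)//.
rewrite -mulSn prednK ?(ltnW p_gt1)//.
by rewrite mulnA -expnSr.
Qed.

Lemma offspring_mean_pow z c h (x : R) : (forall b, h b = x ^+ b) ->
  offspring_mean p z c h = x ^+ c * pgf p%:R^-1 p x ^+ z.
Proof.
move=> hx; elim: z c => [|z IH] c /=; first by rewrite hx expr0 mulr1.
by rewrite !IH /pgf exprD !exprS; ring.
Qed.

Lemma iter_mean_pow n z (x : R) :
  iter n (next_mean p) (fun b => x ^+ b) z = iter n (pgf p%:R^-1 p) x ^+ z.
Proof.
elim: n z => //= n IH z; rewrite (next_mean_ext IH) /next_mean.
by rewrite (@offspring_mean_pow _ _ _ (iter n (pgf p%:R^-1 p) x)) ?expr0 ?mul1r.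
Qed.

(** Read at a fixed coefficient, the identity E A^(Z_1) = f(A) holds for a
    polynomial A as it does for a number; with A a truncated exponential this
    gives the moments. *)
Lemma offspring_mean_coef z c h k (A : {poly R}) :
  (forall b, h b = (A ^+ b)`_k) ->
  offspring_mean p z c h = (A ^+ c * pgf (p%:R^-1)%:P p A ^+ z)`_k.
Proof.
move=> hx; elim: z c => [|z IH] c /=; first by rewrite hx expr0 mulr1.
rewrite !IH /pgf -!coefCM -coefD.
apply: (congr1 (fun P : {poly R} => P`_k)).
by rewrite rmorphB rmorph1 exprD !exprS; ring.
Qed.

Lemma iter_mean_coef n z k (A : {poly R}) :
  iter n (next_mean p) (fun b => (A ^+ b)`_k) z =
  (iter n (pgf (p%:R^-1)%:P p) A ^+ z)`_k.
Proof.
elim: n z => //= n IH z; rewrite (next_mean_ext IH) /next_mean.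
by rewrite (@offspring_mean_coef _ _ _ k (iter n (pgf (p%:R^-1)%:P p) A)) ?expr0 ?mul1r.
Qed.

(** * Moments of the scaled population *)

Definition exp_trunc K (x : R) : {poly R} :=
  \poly_(j < K.+1) (x ^+ j / j`!%:R).

(** Up to order K the truncated exponential series multiplies like the
    exponential. *)
Lemma exp_trunc_pow K x c k : (k <= K)%N ->
  (exp_trunc K x ^+ c)`_k = (c%:R * x) ^+ k / k`!%:R.
Proof.
elim: c k => [|c IH] k kK.
  rewrite expr0 coef1 mul0r; case: k kK => [|k] _; first by rewrite expr0 fact0 divr1.
  by rewrite expr0n /= mul0r.
rewrite exprS coefM -natr1 mulrDl mul1r exprDn mulr_suml.
apply: eq_bigr => -[j /= jk] _; rewrite IH; last by lia.
rewrite coef_poly ifT; last by lia.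
have jk' : (j <= k)%N by lia.
rewrite -[_ *+ 'C(k, j)]mulr_natr.
have := bin_fact jk' => /(congr1 (fun n : nat => n%:R : R)).
rewrite !natrM => <-.
have f0 i : (i`!)%:R != 0 :> R by rewrite pnatr_eq0 -lt0n fact_gt0.
have b0 : ('C(k, j))%:R != 0 :> R by rewrite pnatr_eq0 -lt0n bin_gt0.
move: (c%:R * x) => y.
by field; rewrite !f0 b0.
Qed.

(** The last summand collects the products that use the k-th coefficient of P
    itself. They come from the index tuples that the recursion for the moments
    leaves out. *)
Lemma coef_powE (S : comNzRingType) (P : {poly S}) m k : (0 < k)%N ->
  (P ^+ m)`_k = ((\poly_(i < k) P`_i) ^+ m)`_k + m%:R * P`_0 ^+ m.-1 * P`_k.
Proof.
move=> k0; set A := \poly_(i < k) _.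
have A0 : A`_0 = P`_0 by rewrite coef_poly k0.
have [B PB B0] : exists2 B, P = A + B * 'X^k & B`_0 = P`_k.
  exists (drop_poly k P); last by rewrite coef_drop_poly add0n.
  by rewrite -{1}(poly_take_drop k P); congr (_ + _).
have [C ->] : exists C, P ^+ m =
    A ^+ m + (m%:R * A ^+ m.-1 * B) * 'X^k + C * ('X^k * 'X^k).
  elim: m => [|m [C IH]]; first by exists 0; rewrite !expr0 !mul0r !addr0.
  exists (m%:R * A ^+ m.-1 * B * B + C * P).
  rewrite exprS IH {1}PB.
  case: m IH => [|m] _ /=.
    by rewrite !expr0 !expr1 PB; ring.
  by rewrite PB -!natr1 !exprS; ring.
rewrite !coefD !coefMXn ltnn subnn -exprD coefMXn.
rewrite ifT ?addr0; last by rewrite -addn1 leq_add2l.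
congr (_ + _); rewrite !coef0M B0; congr (_ * _ * _).
  by rewrite -polyC_natr coefC.
by rewrite -A0 -!horner_coef0 horner_exp.
Qed.

Lemma coef_poly_pow (a : nat -> R) m k :
  ((\poly_(i < k) a i) ^+ m)`_k =
  \sum_(i : {ffun 'I_m -> 'I_k} | (\sum_(l < m) i l)%N == k)
     \prod_(l < m) a (i l).
Proof.
rewrite poly_def -[m in LHS]card_ord -prodr_const bigA_distr_bigA coef_sum.
rewrite [RHS]big_mkcond; apply: eq_bigr => /= i _.
rewrite (eq_bigr (fun l => (a (i l))%:P * 'X^(i l))) => [|l _]; last first.
  by rewrite mul_polyC.
rewrite big_split /= prodrXr -rmorph_prod coefCM coefXn eq_sym.
by case: ifP => _; rewrite ?mulr1 ?mulr0.
Qed.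

Definition scaled_moment n k : R :=
  iter n (next_mean p) (fun c => (c%:R / lambda ^+ n) ^+ k / k`!%:R) 1%N.

Lemma scaled_moment0 n : scaled_moment n 0 = 1.
Proof.
rewrite -(iter_mean_cst n 1 1); apply: iter_mean_ext => c.
by rewrite expr0 fact0 divr1.
Qed.

(** The recursion that defines the moments, except that the left side belongs
    to generation n+1: conditioning on the first generation turns the
    exponential generating function M(s) of the scaled moments into
    f(M(s/lambda)). The excluded tuples contribute p times the k-th moment,
    whence the total factor lambda on the right. *)
Lemma scaled_momentE n k : (0 < k)%N ->
  lambda ^+ k * scaled_moment n.+1 k =
  p%:R^-1 * (\sum_(i : {ffun 'I_p -> 'I_k} | (\sum_(l < p) i l)%N == k)
     \prod_(l < p) scaled_moment n (i l)) + lambda * scaled_moment n k.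
Proof.
move=> k0; have ln0 : lambda != 0 by rewrite gt_eqF// lam_gt0.
have pn0 : p%:R != 0 :> R by rewrite gt_eqF.
set P := iter n (pgf (p%:R^-1)%:P p) (exp_trunc k (lambda ^- n)).
have PE j : (j <= k)%N -> P`_j = scaled_moment n j.
  move=> jk; rewrite -[P]expr1 -iter_mean_coef; apply: iter_mean_ext => c.
  by rewrite exp_trunc_pow.
have -> : lambda ^+ k * scaled_moment n.+1 k =
    (pgf (p%:R^-1)%:P p P)`_k.
  rewrite -[pgf _ _ _]expr1 -(iter_mean_coef n.+1) -iter_meanZ.
  apply: iter_mean_ext => c; rewrite exp_trunc_pow// !expr_div_n.
  rewrite mulrA exprS [(lambda * _) ^+ k]exprMn; congr (_ / _).
  have lk : lambda ^+ k != 0 by rewrite expf_neq0.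
  have lnk : (lambda ^+ n) ^+ k != 0 by rewrite !expf_neq0.
  by field; rewrite lk lnk.
rewrite /pgf coefD mulrBl mul1r coefB !coefCM coef_powE// !PE//.
rewrite scaled_moment0 expr1n mulr1 -coef_poly_pow.
have -> : \poly_(i < k) P`_i = \poly_(i < k) scaled_moment n i.
  apply/polyP => i; rewrite !coef_poly; case: ifP => // ik.
  by rewrite PE// ltnW.
by rewrite /lam; field.
Qed.
End Generations.

(** The distance to the fixed point contracts by theta up to an error that
    tends to 0. *)
Lemma affine_rec_cvg (R : realType) (theta r : R) (x u : nat -> R) :
  0 <= theta < 1 -> (forall n, x n.+1 = theta * x n + u n) ->
  u @ \oo --> r -> x @ \oo --> r / (1 - theta).
Proof.
move=> /andP[t0 t1] xE ur; set l := r / _.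
have t1' : 0 < 1 - theta by rewrite subr_gt0.
apply/cvgrPdist_le => e e0.
have e2 : 0 < e / 2 * (1 - theta) by rewrite mulr_gt0 ?divr_gt0.
move/cvgrPdist_le : ur => /(_ _ e2) [N _ uN].
have lE : l = theta * l + r by rewrite /l; field; rewrite gt_eqF.
have step j : `|l - x (N + j)%N| <= theta ^+ j * `|l - x N| + e / 2.
  elim: j => [|j IH]; first by rewrite addn0 expr0 mul1r lerDl divr_ge0 ?ltW.
  rewrite addnS xE {1}lE (_ : _ - _ = theta * (l - x (N + j)%N) +
    (r - u (N + j)%N)); last by ring.
  apply: (le_trans (ler_normD _ _)); rewrite normrM (ger0_norm t0).
  have := uN (N + j)%N (leq_addr _ _) => /= uj.
  apply: (le_trans (lerD (ler_wpM2l t0 IH) uj)).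
  rewrite exprS le_eqVlt; apply/orP; left; apply/eqP; ring.
have [M _ gM] : \forall n \near \oo, `|theta ^+ n * `|l - x N| | <= e / 2.
  have : (fun n => theta ^+ n * `|l - x N|) @ \oo --> 0 * `|l - x N|.
    by apply: cvgMl; apply: cvg_expr; rewrite ger0_norm.
  rewrite mul0r => /cvgr0Pnorm_le; apply; exact: divr_gt0.
exists (N + M)%N => // n /= NMn.
have Nn : (N <= n)%N by exact: leq_trans (leq_addr _ _) NMn.
rewrite -(subnKC Nn); apply: (le_trans (step _)).
rewrite [leRHS](splitr e) lerD2r (le_trans (ler_norm _))// gM//=.
by rewrite leq_subRL.
Qed.

(** By induction on k, scaled_momentE is for k > 1 an affine recursion in n
    with contraction factor lambda^(1-k) and convergent inhomogeneous term;
    the fixed point is the k-th term of the sequence. *)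
Lemma scaled_moment_cvg (R : realType) (p : nat) (p_gt1 : (1 < p)%N) k :
  (scaled_moment R p)^~ k @ \oo --> mom R p k / k`!%:R.
Proof.
elim/ltn_ind: k => -[|[|k]] IH.
- under eq_cvg do rewrite scaled_moment0//.
  by rewrite mom0 fact0 divr1; exact: cvg_cst.
- rewrite mom1 divr1.
  have -> : (scaled_moment R p)^~ 1%N = fun=> 1.
    apply/funext; elim=> [|n IHn].
      by rewrite /scaled_moment/= expr0 !divr1 expr1.
    have := scaled_momentE R p_gt1 n (ltn0Sn 0).
    rewrite IHn big1 => [|i /eqP]; last first.
      by rewrite big1 // => l _; rewrite (ord1 (i l)).
    rewrite mulr0 add0r mulr1 expr1 => /(congr1 (fun x => (lam R p)^-1 * x)).
    by rewrite mulKf ?mulVf ?gt_eqF ?lam_gt0.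
  exact: cvg_cst.
set K := k.+2.
set S := fun n => \sum_(i : {ffun 'I_p -> 'I_K} | (\sum_(l < p) i l)%N == K)
   \prod_(l < p) scaled_moment R p n (i l).
have l0 := lam_gt0 R p_gt1; have l1 := lam_gt1 R p_gt1.
have lK : lam R p < lam R p ^+ K by rewrite -[ltLHS]expr1 ltr_eXn2l.
have lK0 : 0 < lam R p ^+ K by exact: exprn_gt0.
have -> : mom R p K / K`!%:R = (p%:R^-1 * (\sum_(i : {ffun 'I_p -> 'I_K} |
    (\sum_(l < p) i l)%N == K) \prod_(l < p) (mom R p (i l) / (i l)`!%:R))
    / lam R p ^+ K) / (1 - lam R p / lam R p ^+ K).
  rewrite momE// /mom_step.
  under eq_bigr => i _.
    rewrite /multinom.
    have -> : K`!%:R / \prod_(l < p) (i l)`!%:R * \prod_(l < p) mom R p (i l) =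
      K`!%:R * \prod_(l < p) (mom R p (i l) / (i l)`!%:R).
      by rewrite big_split /= prodfV; ring.
    over.
  rewrite -mulr_sumr; set T := \sum_(_ | _) _.
  have f0 : K`!%:R != 0 :> R by rewrite pnatr_eq0 -lt0n fact_gt0.
  have p1 : p%:R - 1 != 0 :> R by rewrite subr_eq0 pnatr_eq1 gtn_eqF.
  have pn0 : p%:R != 0 :> R by rewrite pnatr_eq0 -lt0n ltnW.
  have -> : (p%:R - 1)^-1 * ((lam R p - 1) / (lam R p ^+ K - lam R p)) =
     p%:R^-1 / (lam R p ^+ K - lam R p).
    rewrite mulrA; congr (_ / _); rewrite /lam; field; exact/andP.
  field; rewrite f0 pn0 ?(gt_eqF lK0)/= subr_eq0 (gt_eqF lK) //.
apply: (@affine_rec_cvg _ _ _ _ (fun n => p%:R^-1 * S n / lam R p ^+ K)).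
- by rewrite divr_ge0 ?ltW//= ltr_pdivrMr// mul1r.
- move=> n; have := scaled_momentE R p_gt1 n (ltn0Sn k.+1).
  rewrite -/K -/(S n) => /(congr1 (fun x => (lam R p ^+ K)^-1 * x)).
  by rewrite mulKf ?gt_eqF// => ->; ring.
- apply: cvgMl; apply: cvgMr; apply: cvg_big => [|i _]; first exact: add_continuous.
  by apply: cvg_big => [|l _]; [exact: mul_continuous|exact: IH].
Qed.

Lemma iter_meanD (R : realType) p n (h g : nat -> R) z :
  iter n (next_mean p) (fun b => h b + g b) z =
  iter n (next_mean p) h z + iter n (next_mean p) g z.
Proof.
elim: n z => //= n IH z; rewrite (next_mean_ext p IH) /next_mean.
move: (iter n _ h) (iter n _ g) => u v.
by elim: z (0%N) => [|z IHz] c //=; rewrite !IHz; ring.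
Qed.

Lemma iter_mean_sum (R : realType) p n K (h : nat -> nat -> R) z :
  iter n (next_mean p) (fun b => \sum_(k < K) h k b) z =
  \sum_(k < K) iter n (next_mean p) (h k) z.
Proof.
elim: K => [|K IH].
  rewrite big_ord0; transitivity (0 * iter n (next_mean p) (fun=> 0 : R) z).
    by rewrite -iter_meanZ; apply: iter_mean_ext => b; rewrite big_ord0 mul0r.
  by rewrite mul0r.
rewrite big_ord_recr /= -IH -iter_meanD; apply: iter_mean_ext => b.
by rewrite big_ord_recr.
Qed.

Lemma sum_exp_coeff_le (R : realType) (x : R) K : 0 <= x ->
  \sum_(k < K) x ^+ k / k`!%:R <= expR x.
Proof.
move=> x0; have := @nondecreasing_cvgn_le R (series (exp_coeff x)).
rewrite /expR => /(_ _ _ K); rewrite /series/= big_mkord /exp_coeff/=; apply.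
  apply: nondecreasing_series => n _ _; exact: exp_coeff_ge0.
exact: is_cvg_series_exp_coeff.
Qed.

(** * Uniform exponential moments *)

Section ExpBound.
Variables (R : realType) (p : nat).
Hypothesis p_gt1 : (1 < p)%N.
Local Notation lambda := (lam R p).
Local Notation f := (pgf (p%:R^-1 : R) p).

Let l1 := lam_gt1 R p_gt1.
Let l0 := lam_gt0 R p_gt1.

Let r01 : 0 <= (p%:R^-1 : R) <= 1.
Proof. by rewrite invr_ge0 ler0n invf_le1 ?ltr0n ?(ltnW p_gt1)// ler1n ltnW. Qed.

Lemma pgf_le (x y : R) : 0 <= x <= y -> 0 <= f x <= f y.
Proof.
move: r01 => /andP[r0 r1] /andP[x0 xy]; have r1' : 0 <= 1 - (p%:R^-1 : R) by rewrite subr_ge0.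
rewrite /pgf addr_ge0 ?mulr_ge0 ?exprn_ge0//=.
rewrite lerD// ler_wpM2l// lerXn2r// nnegrE (le_trans x0)//.
Qed.

Lemma iter_pgf_le n (x y : R) : 0 <= x <= y -> 0 <= iter n f x <= iter n f y.
Proof. by move=> xy; elim: n => //= n IH; exact: pgf_le. Qed.

Lemma pow1D_le (v : R) m : 0 <= v <= 1 ->
  (1 + v) ^+ m <= 1 + m%:R * v + 4 ^+ m * v ^+ 2.
Proof.
move=> /andP[v0 v1]; elim: m => [|m IH]; first by rewrite !expr0; nra.
rewrite exprSr; apply: (le_trans (ler_wpM2r _ IH)); first lra.
rewrite -[m.+1%:R]natr1 [X in _ <= _ + X * _]exprS; have : m%:R <= (4 : R) ^+ m.
  by rewrite -natrX ler_nat ltnW// ltn_expl.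
have : (0 : R) <= 4 ^+ m by exact: exprn_ge0.
move: (m%:R : R) (4 ^+ m : R) => M K K0 MK.
rewrite -subr_ge0 (_ : _ - _ = v ^+ 2 * (3 * K - M - K * v)); last by ring.
by apply: mulr_ge0; [exact: sqr_ge0|nra].
Qed.

(** The slope of f at 1 is the mean lambda; the factor 4^p bounds the higher
    terms of the expansion. *)
Lemma pgf_quad (v : R) : 0 <= v <= 1 ->
  f (1 + v) <= 1 + lambda * v + 4 ^+ p * v ^+ 2.
Proof.
move=> v01; move: r01 => /andP[r0 r1].
have := ler_wpM2l r0 (pow1D_le p v01).
have pn0 : p%:R != 0 :> R by rewrite pnatr_eq0 -lt0n ltnW.
have -> : p%:R^-1 * (1 + p%:R * v + 4 ^+ p * v ^+ 2) =
  p%:R^-1 + v + p%:R^-1 * (4 ^+ p * v ^+ 2) by field.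
have K0 : 0 <= 4 ^+ p * v ^+ 2 by rewrite mulr_ge0 ?sqr_ge0 ?exprn_ge0.
rewrite /pgf /lam; move: (4 ^+ p * v ^+ 2) K0 ((1 + v) ^+ p) => K K0 w.
move: (p%:R^-1 : R) r0 r1 => r r0 r1 h; nra.
Qed.

(** For small s, 1+s+C*s^2 is a supersolution of M(s) = f(M(s/lambda)):
    inserting it on the right gives 1+s+(C/lambda)*s^2 plus a multiple of s^2
    that does not depend on C, and C/lambda < C leaves room for it. *)
Lemma iter_pgf_exp_small : exists2 s0 : R, 0 < s0 &
  exists C : R, forall n s, 0 <= s <= s0 ->
    iter n f (expR (s / lambda ^+ n)) <= 1 + s + C * s ^+ 2.
Proof.
pose K : R := 4 ^+ p; have K0 : 0 <= K by exact: exprn_ge0.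
(* The first summand absorbs the quadratic error of f; the second one makes
   1+s+C*s^2 exceed exp(s) for s <= 1/2. *)
pose C := 4 * K / (lambda - 1) + 2.
have lm : 0 < lambda - 1 by rewrite subr_gt0.
have C2 : 2 <= C by rewrite lerDr divr_ge0 ?mulr_ge0 ?(ltW lm).
have C0 : 0 < C by exact: lt_le_trans C2.
have CK : C / lambda + 4 * K / lambda ^+ 2 <= C.
  rewrite -subr_ge0 (_ : _ - _ = (C * lambda * (lambda - 1) - 4 * K) / lambda ^+ 2); last first.
    by field; rewrite gt_eqF.
  rewrite divr_ge0 ?exprn_ge0 ?(ltW l0)// subr_ge0 /C.
  have -> : (4 * K / (lambda - 1) + 2) * lambda * (lambda - 1) =
      lambda * (4 * K + 2 * (lambda - 1)) by field; rewrite gt_eqF.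
  nra.
exists C^-1; first by rewrite invr_gt0.
exists C => n; elim: n => [|n IH] s /andP[s0 sC] /=.
  rewrite expr0 divr1.
  have s12 : s <= 2^-1 by rewrite (le_trans sC)// lef_pV2 ?posrE.
  have := expR_ge1Dx (- s); rewrite expRN => es.
  have e0 := expR_gt0 s.
  have : expR s * (1 - s) <= 1 by rewrite mulrC -ler_pdivlMr// div1r.
  move=> h; rewrite -(@ler_pM2r _ (1 - s)); last lra.
  apply: (le_trans h); rewrite -subr_ge0.
  rewrite (_ : _ - _ = s ^+ 2 * (C * (1 - s) - 1)); last by ring.
  by rewrite mulr_ge0 ?sqr_ge0//; nra.
rewrite exprS invfM mulrA.
have sl : 0 <= s / lambda by rewrite divr_ge0// ltW.
have sls : s / lambda <= s by rewrite ler_pdivrMr// ler_peMr// ltW.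
pose v := s / lambda + C * (s / lambda) ^+ 2.
have v0 : 0 <= v by rewrite addr_ge0// mulr_ge0 ?sqr_ge0 ?ltW.
have Cs : C * (s / lambda) <= 1.
  by rewrite mulrC -ler_pdivlMr// div1r (le_trans sls).
have v2 : v <= 2 * (s / lambda) by rewrite /v; nra.
have v1 : v <= 1 by nra.
apply: (@le_trans _ _ (f (1 + v))).
  have /IH h : 0 <= s / lambda <= C^-1 by rewrite sl (le_trans sls).
  apply: (andP (pgf_le _)).2; rewrite addrA h andbT.
  have := @iter_pgf_le n 0 (expR (s / lambda / lambda ^+ n)).
  rewrite lexx expR_ge0 => /(_ isT) /andP[h0 h1]; exact: le_trans h1.
apply: (le_trans (pgf_quad _)); first by rewrite v0.
rewrite -/K /v.
have -> : lambda * (s / lambda + C * (s / lambda) ^+ 2) = s + C / lambda * s ^+ 2.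
  by field; rewrite gt_eqF.
have : K * v ^+ 2 <= 4 * K / lambda ^+ 2 * s ^+ 2.
  rewrite (_ : 4 * K / lambda ^+ 2 * s ^+ 2 = K * (2 * (s / lambda)) ^+ 2); last first.
    by field; rewrite gt_eqF.
  by rewrite ler_wpM2l// lerXn2r// nnegrE// mulr_ge0.
rewrite -/v; have := ler_wpM2r (sqr_ge0 s) CK.
rewrite mulrDl; lra.
Qed.

(** The relation M(s) = f(M(s/lambda)) carries a bound from s / lambda to s,
    so smallness of s can be dropped. *)
Lemma iter_pgf_exp_bounded (s : R) : 0 <= s ->
  exists B : R, forall n, iter n f (expR (s / lambda ^+ n)) <= B.
Proof.
move=> s0; have [e e0 [C eC]] := iter_pgf_exp_small.
have [j sj] : exists j, s / lambda ^+ j <= e.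
  have : (fun j => s * lambda^-1 ^+ j) @ \oo --> s * 0.
    apply: cvgMr; apply: cvg_expr.
    by rewrite ger0_norm ?invr_ge0 ?(ltW l0)// invf_lt1.
  rewrite mulr0 => /cvgr0Pnorm_le /(_ _ e0) [j _ /(_ j (leqnn j))] /= h.
  exists j; rewrite -exprVn; exact: le_trans (ler_norm _) h.
elim: j s s0 sj => [|j IH] s s0 sj.
  exists (1 + e + `|C| * e ^+ 2) => n.
  rewrite expr0 divr1 in sj.
  apply: (le_trans (eC n s _)); first by rewrite s0.
  apply: lerD; first by rewrite lerD2l.
  apply: (le_trans (ler_wpM2r (sqr_ge0 _) (ler_norm C))).
  by rewrite ler_wpM2l// lerXn2r// nnegrE// ltW.
have [|| B hB] := IH (s / lambda).
- by rewrite divr_ge0// ltW.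
- by rewrite -mulrA -invfM -exprS.
exists (Num.max (expR s) (f B)) => -[|n] /=.
  by rewrite expr0 divr1 le_max lexx.
rewrite le_max; apply/orP; right; rewrite exprS invfM mulrA.
apply: (andP (pgf_le _)).2; rewrite hB andbT.
have := @iter_pgf_le n 0 (expR (s / lambda / lambda ^+ n)).
rewrite lexx expR_ge0 => /(_ isT) /andP[h0 h1]; exact: le_trans h1.
Qed.

(** The exponential generating function of the moments is entire. This is what
    makes the moment problem determinate. *)
Lemma mom_series_bounded (s : R) : 0 <= s ->
  exists B : R, forall K, \sum_(k < K) s ^+ k * (mom R p k / k`!%:R) <= B.
Proof.
move=> s0; have [B hB] := iter_pgf_exp_bounded s0; exists B => K.
have : (fun n => \sum_(k < K) s ^+ k * scaled_moment R p n k) @ \oo -->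
    \sum_(k < K) s ^+ k * (mom R p k / k`!%:R).
  apply: cvg_big => [|i _]; first exact: add_continuous.
  apply: cvgMr; exact: scaled_moment_cvg.
move=> h; rewrite -(cvg_lim _ h)//; apply: limr_le; first exact: cvgP h.
apply: nearW => n; apply: le_trans (hB n).
rewrite -[leRHS]expr1 -iter_mean_pow.
under eq_bigr do rewrite -iter_meanZ.
rewrite -(iter_mean_sum p n K
  (fun k b => s ^+ k * ((b%:R / lambda ^+ n) ^+ k / k`!%:R)) 1%N).
apply: iter_mean_le => // b _.
rewrite -expRM_natl mulrCA.
have sb : 0 <= s * (b%:R / lambda ^+ n).
  by rewrite mulr_ge0// divr_ge0// exprn_ge0// ltW.
apply: le_trans (sum_exp_coeff_le K sb).
by apply: ler_sum => k _; rewrite mulrA -exprMn.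
Qed.
End ExpBound.

(** * Measurability, carriers and summable increments *)

Lemma continuous_measurable_EFin (R : realType) (f : R -> R)
    (A : set (measurableTypeR R)) :
  continuous f -> measurable A -> measurable_fun A (fun x => (f x)%:E).
Proof.
move=> cf mA; apply/measurable_EFinP; apply: measurable_funTS.
exact: continuous_measurable_fun.
Qed.

Lemma summable_increments_cvg d (T : measurableType d) (R : realType)
    (m : {measure set T -> \bar R}) (E : set T) (u : nat -> T -> R) (M : R) :
  measurable E -> (forall n, measurable_fun E (u n)) ->
  (forall N,
    \sum_(n < N) \int[m]_(x in E) (`|u n.+1 x - u n x|)%:E <= M%:E)%E ->
  {ae m, forall x, E x -> cvgn (u^~ x)}.
Proof.
move=> mE mu uM.
pose S x := (\sum_(n <oo) (`|u n.+1 x - u n x|)%:E)%E.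
have md n : measurable_fun E (fun x => (`|u n.+1 x - u n x|)%:E).
  by apply/measurable_EFinP; apply: measurableT_comp => //; exact: measurable_funB.
have mS : measurable_fun E S.
  by apply: ge0_emeasurable_sum => // n x _ _; rewrite lee_fin.
have iS : m.-integrable E S.
  apply/integrableP; split => //.
  rewrite (eq_integral S) => [|x _]; last first.
    by rewrite gee0_abs// nneseries_ge0// => n _ _; rewrite lee_fin.
  rewrite integral_nneseries//.
  apply: le_lt_trans (ltry M); apply: lime_le.
    by apply: is_cvg_nneseries => n _ _; apply: integral_ge0 => x _; rewrite lee_fin.
  by apply: nearW => N; rewrite big_mkord.
have := integrable_ae mE iS; apply: filterS => x Sx Ex.
have {Sx Ex} Sx := Sx Ex.
have : cvgn [normed series (telescope (u^~ x))].
  apply: nondecreasing_is_cvgn.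
    by apply: nondecreasing_series => n _ _; exact: normr_ge0.
  exists (fine (S x)) => _ [N _ <-].
  rewrite -lee_fin fineK// -sumEFin.
  apply: (@nneseries_lim_ge R (fun n => `|u n.+1 x - u n x|%:E) xpredT 0 N).
  by move=> n _ _; rewrite lee_fin.
move=> /normed_cvg h.
rewrite (_ : u^~ x = fun n => u 0%N x + series (telescope (u^~ x)) n); last first.
  by apply/funext => n; rewrite -eq_sum_telescope.
by apply: is_cvgD => //; exact: is_cvg_cst.
Qed.

(** A probability carried by the positive half-line can be integrated there,
    where powers are nonnegative. *)
Lemma integral_pos_carrier (R : realType)
    (nu : probability (measurableTypeR R) R) (f : R -> \bar R) :
  nu `](0 : R), +oo[%classic = 1%E ->
  measurable_fun setT (f : measurableTypeR R -> \bar R) ->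
  (\int[nu]_x f x = \int[nu]_(x in `]0%R, +oo[) f x)%E.
Proof.
move=> nu1 mf; set D := `]0, +oo[%classic : set (measurableTypeR R).
have mD : measurable D by exact: measurable_itv.
rewrite [RHS]integral_mkcond; apply: ae_eq_integral => //.
  by apply/(measurable_restrictT _ mD); exact: measurable_funTS.
have nD : nu (~` D) = 0%E by rewrite probability_setC// nu1 subee.
exists (~` D); split; [exact: measurableC|exact: nD|].
move=> x /= xf xD; apply: xf => _; by rewrite patchE mem_set.
Qed.

(** * The branching process on the unit interval *)

Section Coding.
Variable (R : realType).
Local Notation leb := (@lebesgue_measure R).
Local Notation D := (`[0, 1[%classic : set (measurableTypeR R)).

(** Both sides agree on bounded intervals. *)
Lemma lebesgue_affine (a k : R) (k0 : 0 < k) (A : set (measurableTypeR R)) :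
  measurable A ->
  pushforward leb
    (fun y : measurableTypeR R => (a + k * y) : measurableTypeR R) A =
  (k^-1%:E * leb A)%E.
Proof.
move=> mA.
have kV0 : 0 <= k^-1 by rewrite invr_ge0 ltW.
have mphi : measurable_fun setT
    (fun y : measurableTypeR R => (a + k * y) : measurableTypeR R).
  by apply: measurable_funD => //; exact: measurable_funM.
pose phi := (fun y : measurableTypeR R => (a + k * y) : measurableTypeR R).
pose im := measure_function_pushforward__canonical__measure_function_Measure leb mphi.
pose m := mscale (NngNum (ltW k0)) im.
have : leb A = m A.
  apply: lebesgue_measure_unique => // _ [[b c]] _ <-.
  change (leb `]b, c] = k%:E * leb (phi @^-1` `]b, c]%classic))%E.
  have -> : phi @^-1` `]b, c] = `](b - a) / k, (c - a) / k]%classic.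
    apply/seteqP; split => x /=; rewrite !in_itv /= ltr_pdivrMr// ler_pdivlMr//;
      by rewrite ltrBlDr lerBrDr ![x * k + a]addrC ![x * k]mulrC.
  rewrite !lebesgue_measure_itv/= !lte_fin ltr_pM2r ?invr_gt0// ltrD2r.
  case: ifP => _; last by rewrite mule0.
  rewrite -!EFinD -EFinM; congr (_%:E); field; exact: lt0r_neq0.
by move=> ->; rewrite /m /mscale /= muleA -EFinM mulVf ?lt0r_neq0// mul1e.
Qed.

Lemma integral_affine (a k : R) (f : R -> \bar R) : 0 < k ->
  measurable_fun setT (f : measurableTypeR R -> \bar R) ->
  (forall x, 0 <= f x)%E ->
  (\int[leb]_(x in `[a, (a + k)%R[) f x =
   k%:E * \int[leb]_(y in D) f (a + k * y)%R)%E.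
Proof.
move=> k0 mf f0.
have kV0 : 0 <= k^-1 by rewrite invr_ge0 ltW.
have mphi : measurable_fun setT
    (fun y : measurableTypeR R => (a + k * y) : measurableTypeR R).
  by apply: measurable_funD => //; exact: measurable_funM.
have -> : D = (fun y : measurableTypeR R => (a + k * y) : measurableTypeR R) @^-1`
    `[a, (a + k)[%classic.
  apply/seteqP; split => x /=; rewrite !in_itv /= lerDl ltrD2l pmulr_rge0//;
    by rewrite gtr_pMr.
rewrite -(ge0_integral_pushforward mphi leb (f := f))//; last exact: measurable_funTS.
rewrite (@eq_measure_integral _ _ _ _ (mscale (NngNum kV0) leb)
  (measure_function_pushforward__canonical__measure_function_Measure leb mphi)); last first.
  by move=> A mA _; exact: (lebesgue_affine a k0 mA).
rewrite ge0_integral_mscale//=; last exact: measurable_funTS.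
by rewrite muleA -EFinM mulfV ?lt0r_neq0// mul1e.
Qed.

(** A uniform variable x falls below r with probability r, and conditionally
    on either outcome the rescaled remainder is again uniform: one variable
    supplies a coin toss and a fresh variable. *)
Lemma integral_split_unit (r : R) (h1 h2 : R -> \bar R) : 0 < r < 1 ->
  measurable_fun setT (h1 : measurableTypeR R -> \bar R) ->
  measurable_fun setT (h2 : measurableTypeR R -> \bar R) ->
  (forall x, 0 <= h1 x)%E -> (forall x, 0 <= h2 x)%E ->
  (\int[leb]_(x in D)
     (if (x < r)%R then h1 (x / r)%R else h2 ((x - r) / (1 - r))%R) =
   r%:E * \int[leb]_(y in D) h1 y + (1 - r)%R%:E * \int[leb]_(y in D) h2 y)%E.
Proof.
move=> /andP[r0 r1] mh1 mh2 h10 h20; have r1' : 0 < 1 - r by rewrite subr_gt0.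
have mg1 : measurable_fun setT (fun x : measurableTypeR R => h1 (x / r)).
  by apply: (measurableT_comp mh1); exact: measurable_funM.
have mg2 : measurable_fun setT (fun x : measurableTypeR R => h2 ((x - r) / (1 - r))).
  apply: (measurableT_comp mh2); apply: measurable_funM => //.
  exact: measurable_funB.
have DE : D = `[0, r[ `|` `[r, 1[.
  by rewrite -itv_bndbnd_setU// bnd_simp ltW.
rewrite {1}DE ge0_integral_setU//=; last 3 first.
- apply: measurable_funS (measurable_fun_ifT _ mg1 mg2) => //.
  exact: measurable_fun_ltr.
- by move=> x _; case: ifP.
- rewrite disj_set2E; apply/eqP/seteqP; split => // x [] /=.
  by rewrite !in_itv/= => /andP[_ xr] /andP[/(lt_le_trans xr)]; rewrite ltxx.
congr (_ + _)%E.
  transitivity (\int[leb]_(x in `[0%R, r[) h1 (x / r)%R)%E.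
    apply: eq_integral => x.
    by rewrite inE /= in_itv /= => /andP[_ ->].
  have := @integral_affine 0 r (fun x => h1 (x / r)) r0 mg1.
  rewrite add0r => ->//; congr (_ * _)%E; apply: eq_integral => y _.
  by rewrite add0r [r * y]mulrC mulfK// gt_eqF.
transitivity (\int[leb]_(x in `[r, 1%R[) h2 ((x - r) / (1 - r))%R)%E.
  apply: eq_integral => x.
  by rewrite inE /= in_itv /= => /andP[xr _]; rewrite ltNge xr.
have := @integral_affine r (1 - r) (fun x => h2 ((x - r) / (1 - r))) r1' mg2.
rewrite subrKC => ->//; congr (_ * _)%E; apply: eq_integral => y _.
by rewrite addrAC subrr add0r [_ * y]mulrC mulfK// gt_eqF.
Qed.

Variable p : nat.
Hypothesis p_gt1 : (1 < p)%N.
Local Notation r := (p%:R^-1 : R).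

(** Runs the offspring of z individuals off the single uniform variable x; the
    second component is the uniform variable that remains for later
    generations. *)
Fixpoint draw (z c : nat) (x : R) : nat * R :=
  if z is z'.+1 then
    if x < r then draw z' (c + p)%N (x / r) else draw z' c.+1 ((x - r) / (1 - r))
  else (c, x).

Fixpoint population (n z : nat) (x : R) : nat :=
  if n is n'.+1 then population n' (draw z 0 x).1 (draw z 0 x).2 else z.

Lemma measurable_draw d (T : measurableType d) (F : nat -> R -> T) z c :
  (forall b, measurable_fun setT (F b : measurableTypeR R -> T)) ->
  measurable_fun setT
    ((fun x => F (draw z c x).1 (draw z c x).2) : measurableTypeR R -> T).
Proof.
move=> mF; elim: z c => [|z IH] c /=; first exact: mF.
rewrite (_ : (fun x => _) = fun x : measurableTypeR R => if x < r then
  (fun y => F (draw z (c + p) y).1 (draw z (c + p) y).2) (x / r) else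
  (fun y => F (draw z c.+1 y).1 (draw z c.+1 y).2) ((x - r) / (1 - r))); last first.
  by apply/funext => x; case: ifP.
apply: measurable_fun_ifT; first exact: measurable_fun_ltr.
  by apply: (measurableT_comp (IH _)); exact: measurable_funM.
apply: (measurableT_comp (IH _)); apply: measurable_funM => //.
exact: measurable_funB.
Qed.

(** The remaining uniform variable is independent of the offspring drawn, so F
    may depend on both. *)
Lemma integral_draw (F : nat -> R -> \bar R) (h : nat -> R) z c :
  (forall b, measurable_fun setT (F b : measurableTypeR R -> \bar R)) ->
  (forall b x, 0 <= F b x)%E ->
  (forall b, \int[leb]_(x in D) F b x = (h b)%:E)%E ->
  (\int[leb]_(x in D) F (draw z c x).1 (draw z c x).2 =
   (offspring_mean p z c h)%:E)%E.
Proof.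
move=> mF F0 Fh; elim: z c => [|z IH] c /=; first exact: Fh.
transitivity (\int[leb]_(x in D) (if (x < r)%R then
  (fun y => F (draw z (c + p) y).1 (draw z (c + p) y).2) (x / r)%R else
  (fun y => F (draw z c.+1 y).1 (draw z c.+1 y).2) ((x - r) / (1 - r))%R))%E.
  by apply: eq_integral => x _; case: ifP.
rewrite (@integral_split_unit r
  (fun y => F (draw z (c + p) y).1 (draw z (c + p) y).2)
  (fun y => F (draw z c.+1 y).1 (draw z c.+1 y).2))//; last 3 first.
- by rewrite invr_gt0 ltr0n ltnW//= invf_lt1 ?ltr0n ?ltr1n// ltnW.
- exact: measurable_draw.
- exact: measurable_draw.
by rewrite !IH -!EFinM -EFinD.
Qed.

Lemma measurable_population d (T : measurableType d) (F : nat -> T) n z :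
  measurable_fun setT
    ((fun x => F (population n z x)) : measurableTypeR R -> T).
Proof.
elim: n z => [|n IH] z /=; first exact: measurable_cst.
exact: (@measurable_draw _ _ (fun b x => F (population n b x))).
Qed.

Lemma integral_population (h : nat -> R) n z : (forall b, 0 <= h b) ->
  (\int[leb]_(x in D) (h (population n z x))%:E =
   (iter n (next_mean p) h z)%:E)%E.
Proof.
move=> h0; elim: n z => [|n IH] z /=.
  rewrite integral_cst//= lebesgue_measure_itv/= lte_fin ltr01.
  by rewrite sube0 mule1.
apply: (@integral_draw (fun b x => (h (population n b x))%:E)) => //.
- by move=> b; exact: (@measurable_population _ _ (fun b => (h b)%:E)).
- by move=> b x; rewrite lee_fin.
Qed.

Lemma measurable_population2 d (T : measurableType d)
    (F : nat -> nat -> T) n z :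
  measurable_fun setT
    ((fun x => F (population n z x) (population n.+1 z x)) :
      measurableTypeR R -> T).
Proof.
elim: n z => [|n IH] z; first exact: (@measurable_population _ _ (F z) 1).
exact: (@measurable_draw _ _ (fun b x => F (population n b x) (population n.+1 b x))).
Qed.

(** Joint law of two consecutive generations, needed because convergence of
    the scaled population rests on its increments. *)
Lemma integral_population2 (h : nat -> nat -> R) n z :
  (forall b c, 0 <= h b c) ->
  (\int[leb]_(x in D) (h (population n z x) (population n.+1 z x))%:E =
   (iter n (next_mean p) (fun b => next_mean p (h b) b) z)%:E)%E.
Proof.
move=> h0; elim: n z => [|n IH] z.
  exact: (@integral_population (h z) 1).
apply: (@integral_draw (fun b x => (h (population n b x) (population n.+1 b x))%:E)) => //.
- by move=> b; exact: (@measurable_population2 _ _ (fun b c => (h b c)%:E)).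
- by move=> b x; rewrite lee_fin.
Qed.

Local Notation lambda := (lam R p).
Definition scaled_population n (x : R) : R := (population n 1 x)%:R / lambda ^+ n.

Lemma measurable_scaled_population n :
  measurable_fun setT (scaled_population n : measurableTypeR R -> R).
Proof. exact: (@measurable_population _ _ (fun b => b%:R / lambda ^+ n)). Qed.

(** Given Z_n, the increment of the martingale Z_n / lambda^n has mean 0 and
    variance Z_n * offspring_var / lambda^(2n+2); and Z_n has mean lambda^n. *)
Lemma scaled_increment n :
  (\int[leb]_(x in D)
     ((scaled_population n.+1 x - scaled_population n x) ^+ 2)%R%:E =
    (offspring_var R p / lambda ^+ 2 * lambda^-1 ^+ n)%R%:E)%E.
Proof.
have l0 := lam_gt0 R p_gt1.
rewrite (@integral_population2 (fun b c =>
  (c%:R / lambda ^+ n.+1 - b%:R / lambda ^+ n) ^+ 2)) => [|b c]; last exact: sqr_ge0.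
congr (_%:E).
have ln : lambda ^+ n != 0 by rewrite expf_neq0// gt_eqF.
transitivity (iter n (next_mean p)
  (fun b => offspring_var R p / lambda ^+ n.+1 ^+ 2 * b%:R) 1%N).
  apply: iter_mean_ext => b.
  have := @offspring_mean_quad R p p_gt1 b 0 (lambda ^+ n.+1 ^- 2)
    (- 2 / lambda ^+ n.+1 * (b%:R / lambda ^+ n)) ((b%:R / lambda ^+ n) ^+ 2).
  rewrite [X in _ = X -> _](_ : _ = offspring_var R p / lambda ^+ n.+1 ^+ 2 * b%:R).
    move=> <-; apply: offspring_mean_ext => c; rewrite [lambda ^+ n.+1]exprS.
    by field; rewrite ln gt_eqF.
  by rewrite [lambda ^+ n.+1]exprS; field; rewrite ln gt_eqF.
rewrite iter_meanZ.
rewrite (iter_mean_id R p_gt1) mulr1 [lambda ^+ n.+1]exprS exprVn.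
by field; rewrite ln gt_eqF.
Qed.

(** From |d| <= q^n + d^2 / q^n, where q^2 = 1/lambda balances both terms. *)
Lemma mean_abs_increment_le n :
  (\int[leb]_(x in D)
     (`|scaled_population n.+1 x - scaled_population n x|)%:E <=
   ((1 + offspring_var R p / lambda ^+ 2) * Num.sqrt lambda^-1 ^+ n)%:E)%E.
Proof.
have l0 := lam_gt0 R p_gt1.
set q := Num.sqrt lambda^-1; set v := offspring_var R p / lambda ^+ 2.
have q0 : 0 < q by rewrite sqrtr_gt0 invr_gt0.
have qn0 : 0 < q ^+ n by rewrite exprn_gt0.
have mpop := measurable_scaled_population.
have msq : measurable_fun D
    (fun x => ((scaled_population n.+1 x - scaled_population n x) ^+ 2)%:E).
  apply/measurable_EFinP; apply: measurable_funX; apply: measurable_funB;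
  exact: measurable_funTS.
apply: (@le_trans _ _ (\int[leb]_(x in D) ((q ^+ n)%:E +
    (q ^- n)%:E * ((scaled_population n.+1 x - scaled_population n x) ^+ 2)%:E))%E).
  apply: ge0_le_integral => //.
  - apply/measurable_EFinP; apply: measurableT_comp => //.
    by apply: measurable_funB; exact: measurable_funTS.
  - by apply: emeasurable_funD => //; exact: measurable_funeM.
  - move=> x _; rewrite -EFinM -EFinD lee_fin.
    move: (_ - _) => d; rewrite -(ler_pM2l qn0) mulrDr mulrA mulfV ?gt_eqF// mul1r.
    have := normr_ge0 d; rewrite -(real_normK (num_real d)).
    move: `|d| (q ^+ n) qn0 => a b; nra.
rewrite ge0_integralD//; last 3 first.
- by move=> x _; rewrite lee_fin ltW.
- by move=> x _; rewrite -EFinM lee_fin mulr_ge0 ?sqr_ge0 ?invr_ge0 ?(ltW qn0).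
- exact: measurable_funeM.
rewrite integral_cst//= lebesgue_measure_itv/= lte_fin ltr01 sube0 mule1.
rewrite ge0_integralZl//; last 2 first.
- by move=> x _; rewrite lee_fin sqr_ge0.
- by rewrite lee_fin invr_ge0 ltW.
rewrite scaled_increment -EFinM -EFinD lee_fin -/v.
have -> : lambda^-1 ^+ n = q ^+ n * q ^+ n.
  by rewrite -exprMn -expr2 sqr_sqrtr// invr_ge0 ltW.
rewrite le_eqVlt; apply/orP; left; apply/eqP; field.
by rewrite gt_eqF.
Qed.

Lemma scaled_population_cvg :
  {ae leb, forall x, D x -> cvgn (scaled_population^~ x)}.
Proof.
have l0 := lam_gt0 R p_gt1; have l1 := lam_gt1 R p_gt1.
set q := Num.sqrt lambda^-1; set v := offspring_var R p / lambda ^+ 2.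
have v0 : 0 <= v by rewrite divr_ge0 ?offspring_var_ge0// exprn_ge0// ltW.
have q0 : 0 <= q by exact: sqrtr_ge0.
have q1 : q < 1 by rewrite -sqrtr1 ltr_sqrt// invf_lt1.
apply: (@summable_increments_cvg _ _ _ _ _ _ ((1 + v) / (1 - q))) => //.
  by move=> n; apply: measurable_funTS; exact: measurable_scaled_population.
move=> N; apply: (@le_trans _ _ (\sum_(n < N) ((1 + v) * q ^+ n)%:E)%E).
  by apply: lee_sum => n _; exact: mean_abs_increment_le.
rewrite sumEFin lee_fin -mulr_sumr ler_wpM2l ?addr_ge0//.
rewrite -(ler_pM2l (_ : 0 < 1 - q)) ?subr_gt0// mulfV ?subr_eq0 ?gt_eqF//.
by rewrite -opprB mulNr -subrX1 opprB gerBl exprn_ge0.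
Qed.

Definition limit_population (x : R) : R :=
  fine (limn_esup (fun n => (scaled_population n x)%:E)).

Lemma measurable_limit_population :
  measurable_fun setT (limit_population : measurableTypeR R -> R).
Proof.
rewrite /limit_population; apply: (@measurableT_comp _ _ _ _ _ _ fine) => //.
apply: measurable_fun_limn_esup => n; apply/measurable_EFinP.
exact: measurable_scaled_population.
Qed.

Lemma limit_populationE x :
  cvgn (scaled_population^~ x) -> scaled_population^~ x @ \oo --> limit_population x.
Proof.
move=> /cvg_ex[l xl]; suff -> : limit_population x = l by [].
have /cvg_limn_einf_sup[_] : (scaled_population n x)%:E @[n --> \oo] --> l%:E.
  by apply: cvg_EFin => //; exact: nearW.
by rewrite /limit_population => ->.
Qed.

(** The law of the limit, with the only property of it that is used
    afterwards: by Fatou, a bound on the means of a nonnegative continuous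
    function along the process persists in the limit. *)
Lemma exists_limit_law : exists mu : probability (measurableTypeR R) R,
  forall (g : R -> R) (B : R), continuous g -> (forall x, 0 <= g x) ->
    (\forall n \near \oo,
      iter n (next_mean p) (fun c => g (c%:R / lambda ^+ n)) 1%N <= B) ->
    (\int[mu]_x (g x)%:E <= B%:E)%E.
Proof.
have mW : measurable_fun setT (limit_population : measurableTypeR R -> measurableTypeR R).
  exact: measurable_limit_population.
pose mW_mixin := isMeasurableFun.Build _ _ _ _ _ mW.
pose W : {RV (uniform_prob (@ltr01 R)) >-> measurableTypeR R} :=
  HB.pack (limit_population : measurableTypeR R -> measurableTypeR R) mW_mixin.
exists (distribution (uniform_prob (@ltr01 R)) W) => g B cg g0 gB.
have mg : measurable_fun setT (fun x : measurableTypeR R => (g x)%:E).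
  exact: continuous_measurable_EFin.
have mgW : measurable_fun setT (fun x : measurableTypeR R => (g (limit_population x))%:E).
  exact: (measurableT_comp mg measurable_limit_population).
have mgn n : measurable_fun D (fun x => (g (scaled_population n x))%:E).
  apply: measurable_funTS; exact: (measurableT_comp mg (measurable_scaled_population n)).
rewrite ge0_integral_distribution//.
rewrite (@integral_uniform R 0 1 ltr01 (fun x => (g (limit_population x))%:E))//; last first.
  by move=> x; rewrite lee_fin.
rewrite subr0 invr1 mul1e.
rewrite -integral_itv_bndo_bndc; last exact: measurable_funTS.
have -> : (\int[leb]_(x in D) (g (limit_population x))%:E =
   \int[leb]_(x in D) limn_einf (fun n => (g (scaled_population n x))%:E))%E.
  apply: ge0_ae_eq_integral => //.
  - exact: measurable_funTS.
  - rewrite /limn_einf; apply: measurableT_comp => //.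
    apply: measurable_fun_limn_esup => n; exact: measurableT_comp.
  - move=> x _; rewrite lee_fin //.
  - move=> x _; rewrite limn_einf_lim; apply: lime_ge.
      exact: is_cvg_einfs.
    apply: nearW => n; apply: le_ereal_inf_tmp => _ [m _ <-].
    by rewrite lee_fin.
  - apply: filterS scaled_population_cvg => x xD Dx.
    have h := limit_populationE (xD Dx).
    have /cvg_limn_einf_sup[-> _] : (g (scaled_population n x))%:E @[n --> \oo] -->
        (g (limit_population x))%:E; last by [].
    apply: cvg_EFin; first exact: nearW.
    apply: (cvg_comp _ _ h); exact: cg.
apply: (le_trans (fatou leb _ mgn _)) => //.
  by move=> n x _; rewrite lee_fin.
rewrite limn_einf_lim; apply: lime_le; first exact: is_cvg_einfs.
apply: nearW => n; case: gB => N _ NB.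
apply: (@le_trans _ _ (\int[leb]_(x in D) (g (scaled_population (maxn n N) x))%:E)%E).
  apply: ereal_inf_lbound; exists (maxn n N) => //=; exact: leq_maxl.
rewrite (@integral_population (fun c => g (c%:R / lambda ^+ maxn n N)))// lee_fin.
by apply: NB => /=; exact: leq_maxr.
Qed.
End Coding.

(** * Moments, positivity and support of the limit law *)

Section LimitLaw.
Variables (R : realType) (p : nat).
Hypothesis p_gt1 : (1 < p)%N.
Local Notation lambda := (lam R p).
Variable mu : probability (measurableTypeR R) R.
Hypothesis mu_le : forall (g : R -> R) (B : R),
  continuous g -> (forall x, 0 <= g x) ->
  (\forall n \near \oo,
    iter n (next_mean p) (fun c => g (c%:R / lambda ^+ n)) 1%N <= B) ->
  (\int[mu]_x (g x)%:E <= B%:E)%E.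

Let l0 := lam_gt0 R p_gt1.
Let l1 := lam_gt1 R p_gt1.

Lemma limit_law_cvg_le (g : R -> R) (B : R) :
  continuous g -> (forall x, 0 <= g x) ->
  iter n (next_mean p) (fun c => g (c%:R / lambda ^+ n)) 1%N @[n --> \oo] --> B ->
  (\int[mu]_x (g x)%:E <= B%:E)%E.
Proof.
move=> cg g0 gB; apply/lee_addgt0Pr => e e0; apply: mu_le => //.
by move/cvgr_le : gB; apply; rewrite ltrDl.
Qed.

Lemma continuous_normX k : continuous (fun x : R => `|x| ^+ k).
Proof.
move=> x; apply: (@continuous_comp _ _ _ (fun x : R => `|x|) (fun y => y ^+ k)).
  exact: norm_continuous.
exact: exprn_continuous.
Qed.

Lemma abs_moment_cvg k :
  iter n (next_mean p) (fun c => `|c%:R / lambda ^+ n| ^+ k) 1%N @[n --> \oo] -->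
  mom R p k.
Proof.
have f0 : k`!%:R != 0 :> R by rewrite pnatr_eq0 -lt0n fact_gt0.
rewrite (_ : mom R p k = k`!%:R * (mom R p k / k`!%:R)); last by field.
rewrite (_ : (fun n => _) = fun n => k`!%:R * scaled_moment R p n k).
  by apply: cvgMr; exact: scaled_moment_cvg.
apply/funext => n; rewrite /scaled_moment -iter_meanZ.
apply: iter_mean_ext => c; rewrite ger0_norm ?divr_ge0 ?exprn_ge0 ?(ltW l0)//.
by field.
Qed.

(** The Fatou inequality for |x|^k gives one half. For the other half it is
    applied to e*x^(2k) - |x|^k + 1/(4e), which is e times a square and so
    nonnegative; then e tends to 0. *)
Lemma limit_law_abs_moment k : (\int[mu]_x (`|x| ^+ k)%:E = (mom R p k)%:E)%E.
Proof.
have cX := @continuous_normX.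
have mX j : measurable_fun setT (fun x : measurableTypeR R => (`|x| ^+ j)%:E).
  exact: continuous_measurable_EFin.
have up : (\int[mu]_x (`|x| ^+ k)%:E <= (mom R p k)%:E)%E.
  by apply: limit_law_cvg_le => //; exact: abs_moment_cvg.
apply/eqP; rewrite eq_le up /=.
set I := (\int[mu]_x (`|x| ^+ k)%:E)%E in up *.
have low e : 0 < e -> ((mom R p k)%:E <= I + (e * mom R p k.*2)%:E)%E.
  move=> e0; pose g (x : R) : R := e * (`|x| ^+ k - (2 * e)^-1) ^+ 2.
  have gE x : g x = e * `|x| ^+ k.*2 + (- 1 * `|x| ^+ k + (4 * e)^-1).
    by rewrite /g -muln2 exprM; field; rewrite gt_eqF.
  have cg : continuous g.
    rewrite (_ : g = fun x => e * `|x| ^+ k.*2 + (- 1 * `|x| ^+ k + (4 * e)^-1)).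
      by move=> x; apply: cvgD; [apply: cvgMr; exact: cX|apply: cvgD;
        [apply: cvgMr; exact: cX|exact: cvg_cst]].
    exact/funext.
  have g0 x : 0 <= g x by rewrite mulr_ge0 ?sqr_ge0 ?ltW.
  have gle : (\int[mu]_x (g x)%:E <=
      (e * mom R p k.*2 + (- 1 * mom R p k + (4 * e)^-1))%:E)%E.
    apply: limit_law_cvg_le => //.
    have -> : (fun n => iter n (next_mean p) (fun c => g (c%:R / lambda ^+ n)) 1%N) =
       fun n => e * iter n (next_mean p) (fun c => `|c%:R / lambda ^+ n| ^+ k.*2) 1%N +
        (- 1 * iter n (next_mean p) (fun c => `|c%:R / lambda ^+ n| ^+ k) 1%N + (4 * e)^-1).
      apply/funext => n; rewrite -!iter_meanZ -(iter_mean_cst p_gt1 n (4 * e)^-1 1%N).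
      by rewrite -!iter_meanD; apply: iter_mean_ext => c; rewrite gE.
    apply: cvgD; first by apply: cvgMr; exact: abs_moment_cvg.
    by apply: cvgD; [apply: cvgMr; exact: abs_moment_cvg|exact: cvg_cst].
  have : ((4 * e)^-1%:E <= \int[mu]_x (g x)%:E + I)%E.
    rewrite -ge0_integralD//; last 2 first.
    - by move=> x _; rewrite lee_fin.
    - exact: continuous_measurable_EFin.
    rewrite -[leLHS](mule1) -(@probability_setT _ _ _ mu) -integral_cst//.
    apply: ge0_le_integral => //.
    - by move=> x _; rewrite lee_fin invr_ge0 mulr_ge0 ?ltW.
    - apply: emeasurable_funD => //.
      exact: continuous_measurable_EFin.
    - move=> x _; rewrite -EFinD lee_fin gE.
      have : 0 <= e * `|x| ^+ k.*2 by apply: mulr_ge0; [exact: ltW|exact: exprn_ge0].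
      lra.
  move=> /le_trans /(_ (leeD2r _ gle)).
  have : (0%:E <= I)%E by apply: integral_ge0 => x _; rewrite lee_fin exprn_ge0.
  case: I up => [i| |]// _ _; rewrite -!EFinD !lee_fin; lra.
apply/lee_addgt0Pr => e e0.
have M0 : 0 <= mom R p k.*2.
  have /cvg_lim <- // := @abs_moment_cvg k.*2; apply: limr_ge.
    by apply: cvgP; exact: abs_moment_cvg.
  by apply: nearW => n; apply: iter_mean_ge0 => // b; exact: exprn_ge0.
have d0 : 0 < e / (mom R p k.*2 + 1) by rewrite divr_gt0// ltr_wpDl.
apply: (le_trans (low _ d0)); apply: leeD2l; rewrite lee_fin.
rewrite mulrAC -mulrA ler_piMr ?(ltW e0)// ler_pdivrMr ?mul1r ?lerDl//.
exact: ltr_wpDl.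
Qed.

(** Seen from generation n, the scaled population ends below 1/(2 lambda^n)
    only if the descendants of the Z_n = z individuals fall below half of
    their mean z, an event of probability at most 4 limit_var / z; by
    mean_inverse this tends to 0 on average. *)
Lemma limit_law_Ny0 : mu `]-oo, (0 : R)]%classic = 0%E.
Proof.
set rho := 1 - (lambda - 1) / p%:R.
have p0 : (0 : R) < p%:R by rewrite ltr0n ltnW.
have rho01 : 0 <= rho < 1.
  have l2 : lambda - 1 <= 1.
    by rewrite /lam; have : (0 : R) < p%:R^-1 by rewrite invr_gt0; lra.
  rewrite /rho subr_ge0 ltrBlDr ltrDl divr_gt0 ?subr_gt0// andbT.
  by rewrite ler_pdivrMr// mul1r (le_trans l2)// ler1n ltnW.
pose C := limit_var R p; have C0 : 0 <= C := limit_var_ge0 R p_gt1.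
pose I0 := `]-oo, (0:R)]%classic : set (measurableTypeR R).
have mI0 : measurable I0 by exact: measurable_itv.
have bound n : (mu I0 <= (4 * C * rho ^+ n)%:E)%E.
  pose g x : R := Num.min 1 (Num.max 0 (1 - 2 * lambda ^+ n * x)).
  have ln : 0 < lambda ^+ n by exact: exprn_gt0.
  have g0 x : 0 <= g x by rewrite le_min ler01 le_max lexx.
  have cg : continuous g.
    move=> x; apply: (@continuous_min R R (fun=> 1)
      (fun x => Num.max 0 (1 - 2 * lambda ^+ n * x))); first exact: cvg_cst.
    apply: (@continuous_max R R (fun=> 0)
      (fun x => 1 - 2 * lambda ^+ n * x)); first exact: cvg_cst.
    by apply: cvgB; [exact: cvg_cst|apply: cvgMr; exact: cvg_id].
  apply: (@le_trans _ _ (\int[mu]_x (g x)%:E)%E).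
    rewrite -(setIT I0) -integral_indic//.
    apply: ge0_le_integral => //.
    - by apply/measurable_EFinP; exact: measurable_indic.
    - exact: continuous_measurable_EFin.
    - move=> x _; rewrite lee_fin indicE; case: (boolP (x \in I0)) => // /[!inE].
      rewrite /I0/= in_itv/= => x0; rewrite /g /= le_min lexx le_max.
      by rewrite lerBrDr gerDl -mulrA pmulr_rle0// pmulr_rle0 ?x0 ?orbT.
  apply: mu_le => //; exists n => // N /= nN.
  rewrite -(subnKC nN); set m := (N - n)%N.
  rewrite iterD.
  apply: (@le_trans _ _ (iter n (next_mean p) (fun z => 4 * C * z%:R^-1) 1%N)).
    apply: iter_mean_le => // z z0.
    have z0' : 0 < z%:R :> R by rewrite ltr0n.
    apply: (@le_trans _ _ (iter m (next_mean p) (fun c => 4 / z%:R ^+ 2 *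
       (c%:R / lambda ^+ m - z%:R) ^+ 2) z)).
      apply: iter_mean_le => // c _; rewrite /g.
      have -> : 2 * lambda ^+ n * (c%:R / lambda ^+ (n + m)) = 2 * (c%:R / lambda ^+ m).
        by rewrite exprD; field; rewrite !gt_eqF ?exprn_gt0.
      set y := c%:R / _.
      have -> : 4 / z%:R ^+ 2 * (y - z%:R) ^+ 2 = (2 * (z%:R - y) / z%:R) ^+ 2.
        by field; rewrite gt_eqF.
      rewrite ge_min ge_max sqr_ge0 /=; case: (leP 2^-1 y) => hy.
        by apply/orP; right; apply: le_trans (sqr_ge0 _); lra.
      apply/orP; left.
      have z1 : 1 <= z%:R :> R by rewrite ler1n.
      apply: exprn_ege1; rewrite ler_pdivlMr// mul1r; lra.
    rewrite iter_meanZ.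
    apply: (le_trans (ler_wpM2l _ (@scaled_second_moment R p p_gt1 m z z%:R))).
      by rewrite divr_ge0 ?exprn_ge0 ?(ltW z0').
    rewrite subrr expr0n add0r le_eqVlt -/C; apply/orP; left; apply/eqP; field.
    by rewrite gt_eqF.
  rewrite iter_meanZ; apply: ler_wpM2l; first by rewrite mulr_ge0.
  apply: (le_trans (@mean_inverse R p p_gt1 n 1 _)) => //.
  by rewrite divr1.
apply/eqP; rewrite eq_le measure_ge0 andbT.
apply/lee_addgt0Pr => e e0; rewrite add0e.
have : (fun n => 4 * C * rho ^+ n) @ \oo --> 4 * C * 0.
  apply: cvgMr; apply: cvg_expr; by case/andP: rho01 => ? ?; rewrite ger0_norm.
rewrite mulr0 => /cvgr0Pnorm_le /(_ _ e0) [n _ /(_ n (leqnn n))] /= ne.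
apply: (le_trans (bound n)); rewrite lee_fin; exact: le_trans (ler_norm _) ne.
Qed.

Lemma limit_law_0y : mu `](0 : R), +oo[%classic = 1%E.
Proof.
by rewrite -setCitvl probability_setC// limit_law_Ny0 sube0.
Qed.

(** Reachable populations are spaced by p-1 and reach up to p^n, which
    outgrows lambda^n; so after scaling by lambda^n they come arbitrarily
    close to any x0 > 0, and close enough for the second moment bound to be
    small against d. *)
Lemma reachable_near (x0 d : R) : 0 < x0 -> 0 < d ->
  exists n j, (1 + p.-1 * j <= p ^ n)%N /\
    lambda ^- n ^+ 2 * (((1 + p.-1 * j)%N%:R - lambda ^+ n * x0) ^+ 2 +
      limit_var R p * (1 + p.-1 * j)%N%:R) <= d / 2.
Proof.
move=> x00 d0; have p0 : (0 : R) < p%:R by rewrite ltr0n ltnW.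
have C0 := limit_var_ge0 R p_gt1; set C := limit_var R p in C0 *.
pose A := p%:R ^+ 2 + C * (x0 + 1) : R.
have A0 : 0 < A by rewrite ltr_pwDl ?exprn_gt0// mulr_ge0// addr_ge0// ltW.
have lp : lambda < p%:R.
  have : (0 : R) < p%:R^-1 by rewrite invr_gt0.
  have : (2 : R) <= p%:R by rewrite ler_nat.
  by rewrite /lam; lra.
have cv (a : R) e : 0 <= a < 1 -> 0 < e -> \forall n \near \oo, a ^+ n <= e.
  move=> /andP[a0 a1] e0; have : (fun n => a ^+ n) @ \oo --> (0 : R).
    by apply: cvg_expr; rewrite ger0_norm.
  move=> /cvgr0Pnorm_le /(_ _ e0); apply: filterS => n.
  exact: le_trans (ler_norm _).
have h1 : \forall n \near \oo, lambda^-1 ^+ n <= d / 2 / A.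
  by apply: cv; rewrite ?divr_gt0// invr_ge0 (ltW l0) invf_lt1.
have h2 : \forall n \near \oo, (lambda / p%:R) ^+ n <= (x0 + 1)^-1.
  apply: cv; last by rewrite invr_gt0 addr_gt0.
  by rewrite divr_ge0 ?(ltW l0) ?(ltW p0)// ltr_pdivrMr// mul1r.
have [n [{}h1 {}h2]] : exists n, lambda^-1 ^+ n <= d / 2 / A /\
    (lambda / p%:R) ^+ n <= (x0 + 1)^-1.
  have [n _ /(_ n (leqnn n)) h] := filterI h1 h2; by exists n.
have ln1 : 1 <= lambda ^+ n by rewrite exprn_ege1// ltW.
have ln0 : 0 < lambda ^+ n by exact: lt_le_trans ln1.
have q0 : (0 : R) < p.-1%:R by rewrite ltr0n -ltnS prednK// ltnW.
have y0 : 0 <= lambda ^+ n * x0 / p.-1%:R by rewrite divr_ge0 ?mulr_ge0 ?ltW.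
(* The largest j for which (p-1) j does not exceed lambda^n x0. *)
pose j := Num.truncn (lambda ^+ n * x0 / p.-1%:R).
have /andP[j1 j2] := truncn_itv y0; rewrite -/j in j1 j2.
move: j1 j2; rewrite ler_pdivlMr// ltr_pdivrMr// => j1 j2.
have zE : (1 + p.-1 * j)%N%:R = 1 + p.-1%:R * j%:R :> R by rewrite natrD natrM.
have pE : p.-1%:R = p%:R - 1 :> R by rewrite -[in RHS](prednK (ltnW p_gt1)) -natr1 addrK.
exists n, j; split.
  rewrite -(ler_nat R) zE natrX.
  move: h2; rewrite expr_div_n ler_pdivrMr ?exprn_gt0// mulrC ler_pdivlMr ?addr_gt0//.
  have -> : lambda ^+ n * (x0 + 1) = lambda ^+ n * x0 + lambda ^+ n by ring.
  by apply: le_trans; rewrite addrC lerD// mulrC.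
rewrite zE; set z := _ + _ * _.
have z1 : z <= lambda ^+ n * (x0 + 1).
  by rewrite /z mulrDr mulr1 addrC lerD// mulrC.
have zd : (z - lambda ^+ n * x0) ^+ 2 <= p%:R ^+ 2.
  rewrite -ler_sqrt ?exprn_gt0// !sqrtr_sqr (gtr0_norm p0) ler_norml.
  have : (2 : R) <= p%:R by rewrite ler_nat.
  move: j1 j2; rewrite -natr1 /z pE => j1 j2 p2; apply/andP; split; lra.
apply: (@le_trans _ _ (lambda ^- n ^+ 2 * (A * lambda ^+ n))).
  apply: ler_wpM2l; first exact: sqr_ge0.
  rewrite /A mulrDl; apply: lerD.
    by apply: (le_trans zd); rewrite ler_peMr// exprn_ge0// ltW.
  by rewrite -mulrA ler_wpM2l// mulrC.
have -> : lambda ^- n ^+ 2 * (A * lambda ^+ n) = A * lambda^-1 ^+ n.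
  by rewrite [lambda^-1 ^+ n]exprVn; field; rewrite gt_eqF.
by rewrite mulrC -ler_pdivlMr.
Qed.

(** With positive probability generation n has a size z0 whose scaled value is
    close to x0, and from there the scaled population stays within d of x0
    with probability at least 1/2. *)
Lemma limit_law_itv_gt0 (x0 d : R) : 0 < x0 -> 0 < d ->
  (0 < mu `](x0 - d)%R, (x0 + d)%R[%classic)%E.
Proof.
move=> x00 d0; have d20 : 0 < d ^+ 2 by exact: exprn_gt0.
have [n [j [zn zd]]] := reachable_near x00 d20.
set z0 := (1 + p.-1 * j)%N in zn zd.
pose g (x : R) : R := Num.min 1 ((x - x0) ^+ 2 / d ^+ 2).
have g0 x : 0 <= g x by rewrite le_min ler01 divr_ge0 ?sqr_ge0.
have cg : continuous g.
  move=> x; apply: (@continuous_min R R (fun=> 1) (fun x => (x - x0) ^+ 2 / d ^+ 2)).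
    exact: cvg_cst.
  apply: cvgMl; apply: (@continuous_comp _ _ _ (fun x => x - x0) (fun y => y ^+ 2)).
    by apply: cvgB; [exact: cvg_id|exact: cvg_cst].
  exact: exprn_continuous.
pose k : R := 2^-1 * iter n (next_mean p) (fun c => (c == z0)%:R) 1%N.
have k0 : 0 < k by rewrite mulr_gt0 ?invr_gt0//; apply: reachable_gt0 => //; rewrite muln1.
have gk : (\int[mu]_x (g x)%:E <= (1 - k)%:E)%E.
  apply: mu_le => //; exists n => // N /= nN.
  rewrite -(subnKC nN); set m := (N - n)%N; rewrite iterD.
  apply: (@le_trans _ _ (iter n (next_mean p)
    (fun z => 1 + - 2^-1 * (z == z0)%:R) 1%N)); last first.
    by rewrite iter_meanD iter_meanZ iter_mean_cst// /k mulNr.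
  apply: iter_mean_le => // z z_gt0; have [->{z z_gt0}|zz0] := eqVneq z z0.
    apply: (@le_trans _ _ (iter m (next_mean p) (fun c =>
        lambda ^- n ^+ 2 / d ^+ 2 * (c%:R / lambda ^+ m - lambda ^+ n * x0) ^+ 2) z0)).
      apply: iter_mean_le => // c _; rewrite ge_min; apply/orP; right.
      rewrite exprD le_eqVlt; apply/orP; left; apply/eqP; field.
      by rewrite !gt_eqF ?exprn_gt0.
    rewrite iter_meanZ mulr1.
    have c0 : 0 <= lambda ^- n ^+ 2 / d ^+ 2 by rewrite divr_ge0 ?sqr_ge0.
    apply: (le_trans (ler_wpM2l c0 (scaled_second_moment p_gt1 _ _ _))).
    rewrite mulrAC ler_pdivrMr//; apply: (le_trans zd); lra.
  rewrite mulr0 addr0 -[leRHS](iter_mean_cst p_gt1 m 1 z).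
  by apply: iter_mean_le => // c _; rewrite ge_min lexx.
set U := `](x0 - d), (x0 + d)[%classic : set (measurableTypeR R).
have mU : measurable U by exact: measurable_itv.
have : (mu (~` U) <= (1 - k)%:E)%E.
  apply: le_trans gk; rewrite -(setIT (~` U)) -integral_indic//; last exact: measurableC.
  apply: ge0_le_integral => //.
  - by apply/measurable_EFinP; exact: measurable_indic (measurableC mU).
  - exact: continuous_measurable_EFin.
  - move=> x _; rewrite lee_fin indicE; case: (boolP (x \in ~` U)) => // /[!inE] xU.
    rewrite /g le_min lexx /= ler_pdivlMr// mul1r -(real_normK (num_real (x - x0))).
    rewrite lerXn2r ?nnegrE ?(ltW d0)// leNgt; apply/negP => xd; apply: xU.
    rewrite /U /= in_itv /=; move: xd; rewrite ltr_norml => /andP[]; lra.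
rewrite probability_setC// => h; rewrite lt0e measure_ge0 andbT.
apply/eqP => U0; move: h; rewrite U0 sube0 lee_fin; lra.
Qed.

Lemma limit_law_support : has_support mu `]0, +oo[.
Proof.
split; first exact: limit_law_0y.
move=> x /=; rewrite in_itv/= andbT => x0 U [oU Ux].
have /nbhs_ballP[d /= d0 dU] : nbhs x U by exact: open_nbhs_nbhs.
apply: (lt_le_trans (limit_law_itv_gt0 x0 d0)); apply: le_measure; rewrite ?inE.
- exact: measurable_itv.
- exact: open_measurable.
- by move=> y yd; apply: dU; rewrite -ball_itv in yd.
Qed.

Lemma limit_law_moment k :
  'E_mu[(fun x : measurableTypeR R => (x : R) ^+ k)%R]%E = (mom R p k)%:E.
Proof.
rewrite unlock (integral_pos_carrier limit_law_0y); last first.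
  by apply: (@continuous_measurable_EFin R (fun x => x ^+ k)) => //;
    exact: exprn_continuous.
rewrite -limit_law_abs_moment [RHS](integral_pos_carrier limit_law_0y); last first.
  by apply: (@continuous_measurable_EFin R (fun x => `|x| ^+ k)) => //;
    exact: continuous_normX.
apply: eq_integral => x; rewrite inE/= in_itv/= andbT => x0.
by rewrite gtr0_norm.
Qed.
End LimitLaw.

(** * Moment determinacy on the positive half-line *)

Section Determinacy.
Variable R : realType.
Local Notation D := (`](0 : R), +oo[%classic : set (measurableTypeR R)).
Let mD : measurable D. Proof. exact: measurable_itv. Qed.

(** Open rays form a pi-system that generates the Borel sets. *)
Lemma probability_rays_unique (m1 m2 : probability (measurableTypeR R) R) :
  (forall t : R, m1 `]t, +oo[%classic = m2 `]t, +oo[%classic) ->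
  forall A : set (measurableTypeR R), measurable A -> m1 A = m2 A.
Proof.
move=> m12 A mA.
apply: (@measure_unique _ R (measurableTypeR R) (@RGenOInfty.G R)
  (fun n => `](- n%:R), +oo[%classic) _ _ _ _ m1 m2) => //.
- exact: (RGenOInfty.measurableE R).
- move=> _ _ [x ->] [y ->]; exists (Num.max x y).
  apply/seteqP; split => z /=; rewrite !in_itv/= !andbT gt_max.
    by move=> [-> ->].
  by move=> /andP.
- by move=> n; eexists.
- apply/seteqP; split => // x _; exists (Num.truncn `|x|).+1 => //=.
  rewrite in_itv/= andbT ltrNl (le_lt_trans (ler_norm _))// normrN.
  exact: truncnS_gt.
- by move=> _ [x ->]; exact: m12.
- by move=> n; apply: (le_lt_trans (probability_le1 _ _)) => //; rewrite ltry.
Qed.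

Lemma continuous_expM (s : R) : continuous (fun x : R => expR (s * x)).
Proof.
move=> x; apply: (@continuous_comp _ _ _ (fun x => s * x) (@expR R)).
  exact: mulrl_continuous.
exact: continuous_expR.
Qed.

Variable m : nat -> R.
Hypothesis m_bounded : forall s : R, 0 <= s ->
  exists B : R, forall K, \sum_(k < K) s ^+ k * (m k / k`!%:R) <= B.

Lemma exp_partial_cvg (s x : R) :
  (\sum_(k < n) s ^+ k / k`!%:R * x ^+ k)%:E @[n --> \oo] --> (expR (s * x))%:E.
Proof.
apply: cvg_EFin; first exact: nearW.
have := is_cvg_series_exp_coeff (s * x).
rewrite -[lim _]/(expR (s * x)).
rewrite (_ : series _ = fun n => \sum_(k < n) s ^+ k / k`!%:R * x ^+ k)//.
apply/funext => n; rewrite /series/= big_mkord; apply: eq_bigr => k _.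
by rewrite /exp_coeff/= exprMn mulrAC.
Qed.

Section OneMeasure.
Variable nu : probability (measurableTypeR R) R.
Hypothesis nu_moment :
  forall k, (\int[nu]_(x in D) (x ^+ k)%:E = (m k)%:E)%E.

Lemma integrable_power k : nu.-integrable D (fun x => (x ^+ k)%:E).
Proof.
apply/integrableP; split.
  by apply: (@continuous_measurable_EFin R (fun x => x ^+ k)) => //; exact: exprn_continuous.
have -> : (\int[nu]_(x in D) `|(x ^+ k)%:E| = (m k)%:E)%E; last exact: ltry.
rewrite -nu_moment; apply: eq_integral => x.
rewrite inE /= in_itv/= andbT => x0.
by rewrite ger0_norm// exprn_ge0// ltW.
Qed.

Lemma integral_poly_sum (a : nat -> R) K :
  (\int[nu]_(x in D) (\sum_(k < K) a k * x ^+ k)%:E =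
   (\sum_(k < K) a k * m k)%:E)%E.
Proof.
under eq_integral do rewrite -sumEFin.
rewrite integral_sum//=; last first.
  by move=> k; exact: (integrableZl mD (a k) (integrable_power k)).
rewrite -sumEFin; apply: eq_bigr => k _.
under eq_integral do rewrite EFinM.
by rewrite integralZl//= ?nu_moment//; exact: integrable_power.
Qed.

(** By Fatou, the partial sums of the moment series bound the mean of the
    exponential. *)
Lemma integrable_exp (s : R) : 0 <= s ->
  nu.-integrable D (fun x => (expR (s * x))%:E).
Proof.
move=> s0; have me : measurable_fun D (fun x => (expR (s * x))%:E).
  apply: (@continuous_measurable_EFin R (fun x => expR (s * x))) => //.
  exact: continuous_expM.
apply/integrableP; split => //.
have [B sB] := m_bounded s0.
apply: le_lt_trans (ltry B).
have -> : (\int[nu]_(x in D) `|(expR (s * x))%:E| =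
    \int[nu]_(x in D) limn_einf (fun n =>
    (\sum_(k < n) s ^+ k / k`!%:R * x ^+ k)%:E))%E.
  apply: eq_integral.
  move=> x; rewrite inE/= in_itv/= andbT => x0.
  rewrite ger0_norm ?expR_ge0//; apply/esym.
  have := @cvg_limn_einf_sup R (fun n => (\sum_(k < n) s ^+ k / k`!%:R * x ^+ k)%:E)
    (expR (s * x))%:E; case => //.
  exact: exp_partial_cvg.
apply: (le_trans (fatou nu mD _ _)).
- move=> n; apply/measurable_EFinP; apply: measurable_sum => k.
  by apply: measurable_funM => //; exact: measurable_funX.
- move=> n x; rewrite /= in_itv/= andbT => x0; rewrite lee_fin sumr_ge0// => k _.
  by rewrite mulr_ge0 ?divr_ge0 ?exprn_ge0// ltW.
rewrite limn_einf_lim; apply: lime_le; first exact: is_cvg_einfs.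
apply: nearW => n.
apply: (@le_trans _ _ (\int[nu]_(x in D) (\sum_(k < n) s ^+ k / k`!%:R * x ^+ k)%:E)%E).
  by apply: ereal_inf_lbound; exists n => /=.
rewrite (integral_poly_sum (fun k => s ^+ k / k`!%:R)) lee_fin; apply: le_trans (sB n).
by apply: ler_sum => k _; rewrite mulrAC mulrA.
Qed.

(** The Laplace transform is the alternating moment series, by dominated
    convergence; hence it is determined by the moments. *)
Lemma laplace_cvg (s : R) : 0 <= s ->
  (\sum_(k < n) (- s) ^+ k / k`!%:R * m k)%:E @[n --> \oo] -->
  (\int[nu]_(x in D) (expR (- s * x))%:E)%E.
Proof.
move=> s0.
rewrite (_ : (fun n => _) = fun n =>
  (\int[nu]_(x in D) (\sum_(k < n) (- s) ^+ k / k`!%:R * x ^+ k)%:E)%E); last first.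
  by apply/funext => n; rewrite (integral_poly_sum (fun k => (- s) ^+ k / k`!%:R)).
apply: (@dominated_cvg _ _ _ nu D mD _ _ (fun x => (expR (s * x))%:E)) => //.
- move=> n; apply/measurable_EFinP; apply: measurable_sum => k.
  by apply: measurable_funM => //; exact: measurable_funX.
- by move=> x xD; exact: exp_partial_cvg.
- exact: integrable_exp.
- move=> n x; rewrite /= in_itv/= andbT => x0; rewrite lee_fin.
  apply: (le_trans (ler_norm_sum _ _ _)).
  apply: le_trans (sum_exp_coeff_le n _); last by rewrite mulr_ge0// ltW.
  apply: ler_sum => k _.
  rewrite !normrM normfV normr_nat !normrX normrN (ger0_norm s0) (gtr0_norm x0).
  by rewrite exprMn mulrAC.
Qed.

Lemma integrable_expN (s : R) : 0 <= s ->
  nu.-integrable D (fun x => (expR (- s * x))%:E).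
Proof.
move=> s0; apply: (@le_integrable _ _ _ nu D mD _ (cst 1%:E)).
- by apply: continuous_measurable_EFin => //; exact: continuous_expM.
- move=> x; rewrite /= in_itv/= andbT => x0; rewrite lee_fin.
  by rewrite normr1 ger0_norm ?expR_ge0// -expR0 ler_expR mulNr oppr_le0 mulr_ge0// ltW.
- exact: finite_measure_integrable_cst.
Qed.

Hypothesis nuD : nu D = 1%E.

Lemma ray_mass_cvg (t : R) (g : nat -> R -> R) :
  (forall n, continuous (g n)) -> (forall n x, 0 < x -> 0 <= g n x <= 1) ->
  (forall x, 0 < x -> g n x @[n --> \oo] --> ((t < x)%R%:R : R)) ->
  (\int[nu]_(x in D) (g n x)%:E)%E @[n --> \oo] --> nu `]t, +oo[%classic.
Proof.
move=> cg g01 gt.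
set E := `]t, +oo[%classic : set (measurableTypeR R).
have mE : measurable E by exact: measurable_itv.
have -> : nu E = (\int[nu]_(x in D) (\1_E x)%:E)%E.
  rewrite -(integral_pos_carrier nuD); last first.
    by apply/measurable_EFinP; exact: measurable_indic.
  by rewrite integral_indic// setIT.
apply: (@dominated_cvg _ _ _ nu D mD _ _ (cst 1%:E)) => //.
- by move=> n; exact: continuous_measurable_EFin.
- move=> x; rewrite /= in_itv/= andbT => x0; apply: cvg_EFin; first exact: nearW.
  rewrite indicE (_ : (x \in E) = (t < x)); first exact: gt.
  by apply/idP/idP; rewrite inE /E/= in_itv/= andbT.
- exact: finite_measure_integrable_cst.
- move=> n x; rewrite /= in_itv/= andbT => x0; rewrite lee_fin.
  by have /andP[g0 g1] := g01 n x x0; rewrite ger0_norm.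
Qed.
End OneMeasure.

Lemma pow_onem_ge (e : R) K : 0 <= e <= 1 -> 1 - K%:R * e <= (1 - e) ^+ K.
Proof.
move=> /andP[e0 e1]; elim: K => [|K IH]; first by rewrite mul0r subr0 expr0.
rewrite exprSr; apply: (@le_trans _ _ ((1 - K%:R * e) * (1 - e))); last first.
  by rewrite ler_wpM2r// subr_ge0.
rewrite -natr1; have : 0 <= K%:R * e ^+ 2 by rewrite mulr_ge0 ?sqr_ge0.
nra.
Qed.

Lemma natmul_expN_cvg (a : R) :
  0 < a -> n%:R * expR (- (n%:R * a)) @[n --> \oo] --> (0 : R).
Proof.
move=> a0; have h n : n.+1%:R * expR (- (n.+1%:R * a)) <= 2 / a ^+ 2 * n.+1%:R^-1.
  have n0 : (0 : R) < n.+1%:R by rewrite ltr0n.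
  have := @expR_ge1Dxn R (n.+1%:R * a) 1 _.
  rewrite mulr_ge0 ?(ltW a0)// => /(_ isT) e2.
  rewrite expRN ler_pdivrMr ?expR_gt0//.
  apply: (@le_trans _ _ (2 / a ^+ 2 * n.+1%:R^-1 * ((n.+1%:R * a) ^+ 2 / 2))).
    rewrite le_eqVlt; apply/orP; left; apply/eqP; field.
    by rewrite !gt_eqF.
  rewrite ler_wpM2l ?mulr_ge0 ?invr_ge0 ?exprn_ge0 ?(ltW a0)//.
  by apply: le_trans e2; rewrite lerDr.
rewrite -(cvg_shiftS (fun n : nat => n%:R * expR (- (n%:R * a)))).
apply: (@squeeze_cvgr _ _ _ _ (fun=> 0) (fun n => 2 / a ^+ 2 * n.+1%:R^-1)).
- by apply: nearW => n; rewrite h mulr_ge0 ?expR_ge0.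
- exact: cvg_cst.
- by rewrite -[X in _ --> X](mulr0 (2 / a ^+ 2)); apply: cvgMr; exact: cvg_harmonic.
Qed.

(** With this exponent the functions (1-e^(-nx))^K are about
    exp(-n*e^(n(t-x))), which tends to 1 for x > t and to 0 for x <= t; the
    factor n settles the case x = t. *)
Definition step_exponent (t : R) (n : nat) : nat :=
  Num.truncn (n%:R * expR (n%:R * t)).

Lemma step_approx (t x : R) : 0 < x ->
  (1 - expR (- x) ^+ n) ^+ step_exponent t n @[n --> \oo] -->
  ((t < x)%R%:R : R).
Proof.
move=> x0; pose e n := expR (- x) ^+ n; pose K := step_exponent t.
have e1 n : 0 <= e n <= 1.
  by rewrite exprn_ge0 ?expR_ge0// exprn_ile1 ?expR_ge0// -expR0 ler_expR oppr_le0 ltW.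
have eE n : n%:R * expR (n%:R * t) * e n = n%:R * expR (- (n%:R * (x - t))).
  by rewrite /e -expRM_natl -mulrA -expRD; congr (_ * expR _); ring.
have n0 n : 0 <= n%:R * expR (n%:R * t) by rewrite mulr_ge0 ?expR_ge0.
have [tx|xt] := ltP t x => /=.
  apply: (@squeeze_cvgr _ _ _ _ (fun n => 1 - n%:R * expR (- (n%:R * (x - t)))) (fun=> 1)).
  - apply: nearW => n; have /andP[en0 en1] := e1 n; apply/andP; split.
      apply: le_trans (pow_onem_ge (K n) (e1 n)).
      by rewrite lerD2l lerN2 -eE ler_wpM2r// truncn_le.
    by rewrite exprn_ile1 ?subr_ge0// gerBl.
  - rewrite -[X in _ --> X]subr0; apply: cvgB; first exact: cvg_cst.
    by apply: natmul_expN_cvg; rewrite subr_gt0.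
  - exact: cvg_cst.
apply: (@squeeze_cvgr _ _ _ _ (fun=> 0) (fun n => expR 1 * expR (-1) ^+ n)).
- apply: nearW => n; have /andP[en0 en1] := e1 n.
  rewrite exprn_ge0 ?subr_ge0//=.
  apply: (@le_trans _ _ (expR (- e n) ^+ K n)).
    by rewrite lerXn2r ?nnegrE ?subr_ge0 ?expR_ge0// expR_ge1Dx.
  rewrite -!expRM_natl -expRD ler_expR.
  have h1 : n%:R <= n%:R * expR (n%:R * t) * e n.
    rewrite eE ler_peMr// -expR0 ler_expR oppr_ge0 mulr_ge0_le0// subr_le0//.
  have h2 : n%:R * expR (n%:R * t) * e n <= (K n).+1%:R * e n.
    by rewrite ler_wpM2r// ltW// truncnS_gt.
  have := le_trans h1 h2; rewrite -natr1 mulrDl mul1r; lra.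
- exact: cvg_cst.
- rewrite -[X in _ --> X](mulr0 (expR 1)); apply: cvgMr; apply: cvg_expr.
  by rewrite ger0_norm ?expR_ge0// -expR0 ltr_expR oppr_lt0.
Qed.

Lemma integral_poly_expN_eq (nu1 nu2 : probability (measurableTypeR R) R)
    (P : {poly R}) :
  (forall k, (\int[nu1]_(x in D) (x ^+ k)%:E = (m k)%:E)%E) ->
  (forall k, (\int[nu2]_(x in D) (x ^+ k)%:E = (m k)%:E)%E) ->
  (\int[nu1]_(x in D) (P.[expR (- x)])%:E =
   \int[nu2]_(x in D) (P.[expR (- x)])%:E)%E.
Proof.
move=> h1 h2.
have E (nu : probability (measurableTypeR R) R) :
   (\int[nu]_(x in D) (P.[expR (- x)])%:E =
    \sum_(i < size P) (P`_i)%:E * \int[nu]_(x in D) (expR (- i%:R * x))%:E)%E.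
  transitivity (\int[nu]_(x in D) (\sum_(i < size P) (P`_i)%:E * (expR (- i%:R * x))%:E))%E.
    apply: eq_integral => x _; rewrite horner_coef -sumEFin.
    by apply: eq_bigr => i _; rewrite EFinM -expRM_natl mulrN mulNr.
  rewrite integral_sum//=; last first.
    by move=> i; apply: integrableZl => //; exact: integrable_expN.
  by apply: eq_bigr => i _; rewrite integralZl//; exact: integrable_expN.
rewrite !E; apply: eq_bigr => i _; congr (_ * _)%E.
apply: (cvg_unique _ (laplace_cvg h1 _) (laplace_cvg h2 _)) => //.
Qed.

(** The Laplace transforms agree, so all polynomials in e^(-x) have the same
    mean under both laws. Indicators of rays are limits of such polynomials by
    step_approx. *)
Lemma moment_determinate (nu1 nu2 : probability (measurableTypeR R) R) :
  nu1 D = 1%E -> nu2 D = 1%E ->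
  (forall k, (\int[nu1]_(x in D) (x ^+ k)%:E = (m k)%:E)%E) ->
  (forall k, (\int[nu2]_(x in D) (x ^+ k)%:E = (m k)%:E)%E) ->
  forall A : set (measurableTypeR R), measurable A -> nu1 A = nu2 A.
Proof.
move=> D1 D2 h1 h2; apply: probability_rays_unique => t.
pose P n : {poly R} := (1 - 'X^n) ^+ step_exponent t n.
pose g n x := (P n).[expR (- x)].
have gE n x : g n x = (1 - expR (- x) ^+ n) ^+ step_exponent t n.
  by rewrite /g /P horner_exp !hornerE.
have cg n : continuous (g n).
  move=> x; apply: (@continuous_comp _ _ _ (fun x => expR (- x)) (horner (P n))).
    have := @continuous_expM (-1) x.
    by rewrite (_ : (fun x => _) = fun x => expR (- x)) //; apply/funext => y; rewrite mulN1r.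
  exact: continuous_horner.
have g01 n x : 0 < x -> 0 <= g n x <= 1.
  move=> x0; have e0 : 0 <= expR (- x) ^+ n by rewrite exprn_ge0 ?expR_ge0.
  have e1 : expR (- x) ^+ n <= 1.
    by rewrite exprn_ile1 ?expR_ge0// -expR0 ler_expR oppr_le0 ltW.
  by rewrite gE exprn_ge0 ?exprn_ile1 ?subr_ge0// gerBl.
have gt x : 0 < x -> g n x @[n --> \oo] --> ((t < x)%R%:R : R).
  move=> x0; rewrite (_ : (fun n => _) =
     fun n => (1 - expR (- x) ^+ n) ^+ step_exponent t n); first exact: step_approx.
  by apply/funext.
have := ray_mass_cvg D2 cg g01 gt.
rewrite (_ : (fun n => _) = fun n => (\int[nu1]_(x in D) (g n x)%:E)%E); last first.
  by apply/funext => n; exact: integral_poly_expN_eq.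
move=> c2; exact: (cvg_unique _ (ray_mass_cvg D1 cg g01 gt) c2).
Qed.
End Determinacy.

(** * Existence and uniqueness *)

Lemma moments_on_carrier (R : realType) (m : nat -> R)
    (nu : probability (measurableTypeR R) R) : m 0 = 1 ->
  nu `](0 : R), +oo[%classic = 1%E ->
  (forall k : nat, (0 < k)%N ->
    'E_nu[(fun x : measurableTypeR R => (x : R) ^+ k)%R]%E = (m k)%:E) ->
  forall k, (\int[nu]_(x in `]0%R, +oo[) (x ^+ k)%:E = (m k)%:E)%E.
Proof.
move=> m0 nu1 nuE [|k].
  rewrite m0; under eq_integral do rewrite expr0.
  rewrite integral_cst ?mul1e//; exact: measurable_itv.
rewrite -nuE// unlock [RHS](integral_pos_carrier nu1)//.
by apply: continuous_measurable_EFin => //; exact: exprn_continuous.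
Qed.

Theorem proposition15 (R : realType) (p : nat) (hp : prime p) :
  let P (mu : probability (measurableTypeR R) R) :=
    has_support mu `]0, +oo[ /\
    forall k : nat, (0 < k)%N ->
      'E_mu[(fun x : measurableTypeR R => (x : R) ^+ k)%R]%E = (mom R p k)%:E in
  exists2 mu : probability (measurableTypeR R) R,
    P mu &
    forall nu : probability (measurableTypeR R) R,
      P nu -> forall A : set (measurableTypeR R), measurable A -> nu A = mu A.
Proof.
move=> P; have p_gt1 := prime_gt1 hp.
have [mu mu_le] := exists_limit_law R p_gt1.
have Pmu : P mu.
  split; first exact: (limit_law_support p_gt1 mu_le).
  by move=> k _; exact: (limit_law_moment p_gt1 mu_le).
exists mu => // nu [[nu1 _] nuE]; case: Pmu => [[mu1 _] muE].
apply: (moment_determinate (m := mom R p)) => //.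
- by move=> s s0; exact: mom_series_bounded.
- exact: moments_on_carrier.
- exact: moments_on_carrier.
Qed.
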